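(* For each $m\ge2$: (1) The set of all rigid Maurer-Cartan elements $\omega\in\mathcal{MC}_m$ is in one-to-one correspondence with the set $\mathcal{R}_m$ of elements $x\in\Omega_m^2(-1)$ satisfying $\partial(x)=c^{\boxtimes m}-a^{\boxtimes m}$; the correspondence is characterized by $\omega=e^{\boxtimes m}+\sum_{k\ge1}x^{\diamond k}$. (2) There exists a unique symmetric rigid Maurer-Cartan element in $\mathcal{MC}_m$. (3) If $\omega\in\mathcal{MC}_m$ is rigid, then for every Lie groupoid $G$ the induced tensor product $\otimes_\omega(E_1,\dots,E_m)$ of unital representations up to homotopy $E_1,\dots,E_m$ of $G$ is unital.
   Context: Over $\mathbb{R}$, let $\Omega=\bigoplus_{k\ge1,l}\Omega^k(l)$ be the bigraded vector space where $\Omega^{k}$ has as basis the words of length $k-1$ in the letters $a,b,c$; the empty word $e$ spans $\Omega^1$; a word in which $b$ occurs $r$ times has $l=-r$. Let $\diamond$ be concatenation (unit $e$). Structure maps: $w\circ w'=w\diamond c\diamond w'$; $d_i(e_1\cdots e_{k-1})=e_1\cdots e_{i-1}\,a\,e_i\cdots e_{k-1}$ for $1\le i\le k$ on $\Omega^k$; $\partial$ is the linear map with $\partial e=\partial a=\partial c=0$, $\partial b=c-a$, $\partial(w\diamond w')=\partial(w)\diamond w'+(-1)^{l(w)}w\diamond\partial(w')$. Put $L_1=e$, $L_n=b^{\diamond(n-1)}$ for $n\ge2$. $\Omega_m=\Omega^{\boxtimes m}$, where $(\mathcal{A}\boxtimes\mathcal{B})^k(l)=\bigoplus_{i+j=l}\mathcal{A}^k(i)\otimes\mathcal{B}^k(j)$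 with $\partial(a\boxtimes b)=\partial a\boxtimes b+(-1)^{l(a)}a\boxtimes\partial b$, $d_i(a\boxtimes b)=d_ia\boxtimes d_ib$, $(a\boxtimes b)\circ(a'\boxtimes b')=(-1)^{l(b)l(a')}(a\circ a')\boxtimes(b\circ b')$, and $\diamond$ is extended by the same sign rule $(a_1\boxtimes a_2)\diamond(b_1\boxtimes b_2)=(-1)^{l(a_2)l(b_1)}(a_1\diamond b_1)\boxtimes(a_2\diamond b_2)$, with unit $e^{\boxtimes m}$. $\bar\Omega_m$ is the DGA with $\bar\Omega_m^n=\prod_{k+l=n}\Omega_m^k(l)$, product $a\star b=(-1)^{k(a)|b|}a\circ b$ ($|b|=k(b)+l(b)$), differential $d_{\mathrm{tot}}=\partial+(-1)^n\sum_{i=1}^k(-1)^id_i$ on elements of total degree $n$ in $\Omega_m^k$. $\mathcal{MC}_m$ (universal Maurer-Cartan elements of length $m$) is the set of $\omega=\omega_1+\omega_2+\cdots\in\bar\Omega_m^1$ ($\omega_k\in\Omega_m^k(1-k)$) with $d_{\mathrm{tot}}\omega+\omega\star\omega=0$, $\omega_1=e^{\boxtimes m}$. Each $\omega\in\mathcal{MC}_m$ determines a unique linear map $\Delta_\omega:\Omega\to\Omega_m$ preserving both degrees and commuting with $\circ,\partial,d_i$, with $\Delta_\omega(L_n)=\omega_n$. $\omega$ is rigid if $\Delta_\omega$ is a morphism of unital algebras with respect to $\diamond$. $\omega$ is symmetric if $\hat\sigma(\omega)=\omega$ for all $\sigma\in S_m$, where the transposition of positions $i,i+1$ acts by $a_1\boxtimes\cdots\boxtimes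 a_m\mapsto(-1)^{l(a_i)l(a_{i+1})}a_1\boxtimes\cdots\boxtimes a_{i+1}\boxtimes a_i\boxtimes\cdots\boxtimes a_m$. Let $G$ be a Lie groupoid over $M$; $G_k$ is the manifold of strings $(g_1,\dots,g_k)$ of composable arrows ($s(g_i)=t(g_{i+1})$), $G_0=M$, $s(g_1,\dots,g_k)=s(g_k)$, $t(g_1,\dots,g_k)=t(g_1)$. A representation up to homotopy $(E,R_k)$ is a graded vector bundle $E\to M$ with smooth operations $R_k(g_1,\dots,g_k):E_{s(g_k)}\to E_{t(g_1)}$ of degree $1-k$, $k\ge0$, with $\sum_{j=1}^{k-1}(-1)^jR_{k-1}(g_1,\dots,g_jg_{j+1},\dots,g_k)=\sum_{j=0}^k(-1)^jR_j(g_1,\dots,g_j)\circ R_{k-j}(g_{j+1},\dots,g_k)$; write $\partial=R_0$. It is unital if $R_1$ restricted to units is $\mathrm{id}_E$ and $R_k$, $k\ge2$, vanishes when one argument is a unit. Put $\mathcal{A}_E^k(l)=\Gamma(G_k,\mathrm{Hom}^l(s^*E,t^*E))$ with $(c\circ c')(g_1,\dots,g_{k+k'})=c(g_1,\dots,g_k)\circ c'(g_{k+1},\dots,g_{k+k'})$, $\partial(c)=\partial\circ c-(-1)^lc\circ\partial$, $d_i(c)(g_1,\dots,g_{k+1})=c(g_1,\dots,g_ig_{i+1},\dots,g_{k+1})$. The characteristic map $k_E:\Omega\to\mathcal{A}_E$ is the unique linear map preserving bidegrees and commuting with $\circ,\partial,d_i$ with $k_E(L_n)=R_n$, $n\ge1$.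 For $\omega\in\mathcal{MC}_m$, $\otimes_\omega(E_1,\dots,E_m)$ is the complex $E_1\otimes\cdots\otimes E_m$ with the usual tensor product differential as $R_0$ and, for $n\ge1$, $R_n=m_\boxtimes\big((k_{E_1}\boxtimes\cdots\boxtimes k_{E_m})(\omega_n)\big)$, where $m_\boxtimes(c_1\boxtimes\cdots\boxtimes c_m)(g_1,\dots,g_n)=c_1(g_1,\dots,g_n)\otimes\cdots\otimes c_m(g_1,\dots,g_n)$ (tensor products of graded linear maps with the Koszul sign rule). *)

(* Defs.v *)
(* The real numbers are an arbitrary R : realType. *)
From HB Require Import structures.
From mathcomp Require Import all_boot all_order all_algebra all_fingroup.
From mathcomp Require Import finmap monalg.
From mathcomp Require Import all_classical all_reals all_analysis.

Set Implicit Arguments.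
Unset Strict Implicit.
Unset Printing Implicit Defensive.

Import Order.TTheory GRing.Theory Num.Theory.
Import numFieldNormedType.Exports.

Local Open Scope classical_set_scope.
Local Open Scope ring_scope.

Inductive letter := La | Lb | Lc.

Definition letter_code (x : letter) : option bool :=
  match x with La => None | Lb => Some true | Lc => Some false end.

Definition letter_decode (o : option bool) : letter :=
  match o with None => La | Some true => Lb | Some false => Lc end.

Lemma letter_codeK : cancel letter_code letter_decode.
Proof. by case. Qed.

HB.instance Definition _ := Countable.copy letter (can_type letter_codeK).

Definition word := seq letter.

(* The number of b's; the degree l of a word is its opposite. *)
Definition nb (w : word) : nat := count_mem Lb w.

Section LinearExtension.
Variables (R : realType) (K K1 K2 : choiceType).

Definition lin_ext (f : K1 -> {malg R[K]}) (x : {malg R[K1]}) : {malg R[K]} :=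
  \sum_(u <- msupp x) x@_u *: f u.

Definition bilin_ext (f : K1 -> K2 -> {malg R[K]})
    (x : {malg R[K1]}) (y : {malg R[K2]}) : {malg R[K]} :=
  \sum_(u <- msupp x) \sum_(v <- msupp y) (x@_u * y@_v) *: f u v.

End LinearExtension.

Section Omega.
Variable R : realType.

Definition Omega := {malg R[word]}.

Definition bas (w : word) : Omega := << w >>.

(* x lies in Omega^k(l) *)
Definition homog (k : nat) (l : int) (x : Omega) : Prop :=
  forall w : word, w \in msupp x -> (size w).+1 = k /\ - (nb w)%:Z = l.

Definition dia (x y : Omega) : Omega :=
  bilin_ext (fun u v : word => bas (u ++ v)) x y.

Definition circ (x y : Omega) : Omega := dia (dia x (bas [:: Lc])) y.

(* d_i is meaningful on Omega^k for 1 <= i <= k *)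
Definition face_word (i : nat) (w : word) : word :=
  take i.-1 w ++ La :: drop i.-1 w.

Definition face (i : nat) (x : Omega) : Omega :=
  lin_ext (fun w => bas (face_word i w)) x.

Definition bdry_letter (x : letter) : Omega :=
  if x == Lb then bas [:: Lc] - bas [:: La] else 0.

Fixpoint bdry_word (w : word) : Omega :=
  if w is x :: w' then
    dia (bdry_letter x) (bas w')
      + (-1) ^+ nb [:: x] *: dia (bas [:: x]) (bdry_word w')
  else 0.

Definition bdry (x : Omega) : Omega := lin_ext bdry_word x.

(* L_n = b^(n-1), for n >= 1 *)
Definition Lgen (n : nat) : Omega := bas (nseq n.-1 Lb).

End Omega.

(* Omega^k being free on words of length k-1, the k-th piece of the m-fold box
   power is free on the m-tuples of words of length k-1, and is realised inside
   the free space on all m-tuples of words (see [mhomog]).  The signs are those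
   obtained by iterating the binary rules. *)
Section OmegaM.
Variables (R : realType) (m : nat).

Definition mword := m.-tuple word.

Definition OmegaM := {malg R[mword]}.

Definition mbas (W : mword) : OmegaM := << W >>.

Definition mnb (W : mword) : nat := \sum_(i < m) nb (tnth W i).

(* x lies in Omega_m^k(l) *)
Definition mhomog (k : nat) (l : int) (x : OmegaM) : Prop :=
  forall W : mword, W \in msupp x ->
    (forall i, (size (tnth W i)).+1 = k) /\ - (mnb W)%:Z = l.

(* w (x) ... (x) w *)
Definition mdiag (w : word) : OmegaM := mbas [tuple w | _ < m].

(* (a_1,...,a_m) and (b_1,...,b_m) are shuffled into (a_1 b_1,...,a_m b_m):
   a_i moves past b_j whenever j < i. *)
Definition shuffle_sign (U V : mword) : R :=
  (-1) ^+ (\sum_(i < m) \sum_(j < m | (j < i)%N)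
             nb (tnth U i) * nb (tnth V j))%N.

Definition mdia (x y : OmegaM) : OmegaM :=
  bilin_ext (fun U V : mword => shuffle_sign U V *:
    mbas [tuple tnth U i ++ tnth V i | i < m]) x y.

Definition mcirc (x y : OmegaM) : OmegaM :=
  bilin_ext (fun U V : mword => shuffle_sign U V *:
    mbas [tuple tnth U i ++ Lc :: tnth V i | i < m]) x y.

Definition mface (i : nat) (x : OmegaM) : OmegaM :=
  lin_ext (fun W : mword =>
    mbas [tuple face_word i (tnth W j) | j < m]) x.

(* W_1 (x) ... (x) y (x) ... (x) W_m, with y in position i *)
Definition replace_factor (W : mword) (i : 'I_m) (y : Omega R) : OmegaM :=
  lin_ext (fun w : word =>
    mbas [tuple if j == i then w else tnth W j | j < m]) y.

Definition mbdry (x : OmegaM) : OmegaM :=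
  lin_ext (fun W : mword => \sum_(i < m)
    (-1) ^+ (\sum_(j < m | (j < i)%N) nb (tnth W j))%N *:
      replace_factor W i (bdry_word R (tnth W i))) x.

Definition mdia_exp (x : OmegaM) (n : nat) : OmegaM :=
  iter n (mdia x) (mdiag [::]).

(* Koszul action of s: one sign per inversion; for the transposition of two
   consecutive positions i, i+1 the exponent is nb W_i * nb W_(i+1). *)
Definition mperm (s : {perm 'I_m}) (x : OmegaM) : OmegaM :=
  lin_ext (fun W : mword =>
    ((-1) ^+ (\sum_(i < m) \sum_(j < m | ((i < j) && (s j < s i))%N)
                nb (tnth W (s i)) * nb (tnth W (s j)))%N : R) *:
      mbas [tuple tnth W (s i) | i < m]) x.

(* An element of the product over k of the Omega_m^k, as the sequence of its
   components. *)
Definition bar := nat -> OmegaM.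

(* The piece of total degree n *)
Definition bar_deg (n : int) (x : bar) : Prop :=
  forall k, mhomog k (n - k%:Z) (x k).

(* Total differential of an element x of total degree n *)
Definition dtot (n : int) (x : bar) : bar := fun k =>
  mbdry (x k)
    + (-1 : R) ^ n *: \sum_(1 <= i < k) (-1) ^+ i *: mface i (x k.-1).

(* Product x * y for y of total degree n *)
Definition star (n : int) (x y : bar) : bar := fun k =>
  \sum_(i < k.+1) (-1 : R) ^ (i%:Z * n) *: mcirc (x i) (y (k - i)%N).

Definition MC : set bar := [set om | [/\ bar_deg 1 om,
  forall k, dtot 1 om k + star 1 om om k = 0 & om 1%N = mdiag [::]]].

Definition is_Delta (om : bar) (D : Omega R -> OmegaM) : Prop :=
  [/\ linear D,
      forall k l x, homog k l x -> mhomog k l (D x),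
      forall x y, D (circ x y) = mcirc (D x) (D y),
      forall x, D (bdry x) = mbdry (D x)
    & (forall k l i x, homog k l x -> (1 <= i <= k)%N ->
         D (face i x) = mface i (D x))
      /\ (forall n, (1 <= n)%N -> D (Lgen R n) = om n)].

(* The map Delta_om (for om Maurer-Cartan there is exactly one) *)
Definition Delta (om : bar) : Omega R -> OmegaM :=
  xget (fun _ => 0) [set D | is_Delta om D].

Definition rigid (om : bar) : Prop :=
  Delta om (bas R [::]) = mdiag [::] /\
  forall x y, Delta om (dia x y) = mdia (Delta om x) (Delta om y).

Definition symmetric_bar (om : bar) : Prop :=
  forall (s : {perm 'I_m}) k, mperm s (om k) = om k.

Definition Rset : set OmegaM := [set x |
  mhomog 2 (-1) x /\ mbdry x = mdiag [:: Lc] - mdiag [:: La]].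

(* e + sum_(k >= 1) x^k: the power x^n sits in Omega_m^(n+1). *)
Definition geom_series (x : OmegaM) : bar := fun k =>
  if k is n.+1 then mdia_exp x n else 0.

End OmegaM.

Section Smooth.
Variable R : realType.

Fixpoint Cn (V W : normedModType R) (n : nat) (U : set V) (F : V -> W) : Prop :=
  if n is n'.+1 then
    (forall x, U x -> differentiable F x) /\
    (forall v : V, Cn n' U ('D_v F : V -> W))
  else forall x, U x -> {for x, continuous F}.

Definition smooth_on (V W : normedModType R) (U : set V) (F : V -> W) : Prop :=
  forall n, Cn n U F.

Record chart (X : topologicalType) (n : nat) := Chart {
  chart_dom : set X;
  chart_map :> X -> 'rV[R]_n
}.

(* Smooth atlas; neither Hausdorff nor second countable is assumed here. *)
Record smoothStructure (X : topologicalType) (n : nat) := SmoothStructure {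
  atlas : set (chart X n);
  atlas_open : forall phi, atlas phi -> open (chart_dom phi);
  atlas_inj : forall phi, atlas phi ->
    set_inj (chart_dom phi) (phi : X -> 'rV[R]_n);
  atlas_homeo : forall phi, atlas phi -> forall U : set X,
    U `<=` chart_dom phi -> (open U <-> open (chart_map phi @` U));
  atlas_cover : forall x : X, exists2 phi, atlas phi & chart_dom phi x;
  atlas_compat : forall phi psi, atlas phi -> atlas psi ->
    exists2 F : 'rV[R]_n -> 'rV[R]_n,
      smooth_on (chart_map phi @` (chart_dom phi `&` chart_dom psi)) F &
      forall x, chart_dom phi x -> chart_dom psi x -> psi x = F (phi x)
}.

Section SmoothAt.
Variables (X : topologicalType) (n : nat) (A : smoothStructure X n).

Definition coords k (phi : 'I_k -> chart X n) (q : k.-tuple X) : 'M[R]_(k, n) :=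
  \matrix_(i, j) phi i (tnth q i) 0 j.

(* Let S be a subset of X^k and f a map defined on S `&` D.  Smoothness of f at
   the point p of S: near p, every point of S is in D and f is the restriction
   of a smooth map on an open subset of X^k.  When S is an embedded submanifold
   (as the spaces of composable strings of a Lie groupoid are) this is the usual
   notion. *)
Definition smooth_at k (W : normedModType R) (S D : set (k.-tuple X))
    (f : k.-tuple X -> W) (p : k.-tuple X) : Prop :=
  forall phi : 'I_k -> chart X n,
    (forall i, atlas A (phi i) /\ chart_dom (phi i) (tnth p i)) ->
  exists (O : set 'M[R]_(k, n)) (F : 'M[R]_(k, n) -> W),
    [/\ open O, O (coords phi p), smooth_on O F &
        forall q, S q -> (forall i, chart_dom (phi i) (tnth q i)) ->
          O (coords phi q) -> D q /\ f q = F (coords phi q)].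

Variables (Y : topologicalType) (d : nat) (B : smoothStructure Y d).

Definition smooth_map_at k (S : set (k.-tuple X)) (f : k.-tuple X -> Y)
    (p : k.-tuple X) : Prop :=
  forall chi : chart Y d, atlas B chi -> chart_dom chi (f p) ->
    smooth_at S [set q | chart_dom chi (f q)] (fun q => chi (f q)) p.

Definition smooth_map (f : X -> Y) : Prop :=
  forall p : X, smooth_map_at setT (fun q : 1.-tuple X => f (thead q)) [tuple p].

Definition submersion (f : X -> Y) : Prop :=
  forall (p : X) (phi : chart X n) (chi : chart Y d),
    atlas A phi -> chart_dom phi p -> atlas B chi -> chart_dom chi (f p) ->
  exists (O : set 'rV[R]_n) (F : 'rV[R]_n -> 'rV[R]_d),
    [/\ open O, O (phi p), smooth_on O F,
        forall q, chart_dom phi q -> O (phi q) ->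
          chart_dom chi (f q) /\ chi (f q) = F (phi q)
      & forall w : 'rV[R]_d, exists v : 'rV[R]_n, 'D_v F (phi p) = w].

End SmoothAt.

Record lieGroupoid := LieGroupoid {
  obj : topologicalType;
  arr : topologicalType;
  obj_dim : nat;
  arr_dim : nat;
  obj_smooth : smoothStructure obj obj_dim;
  arr_smooth : smoothStructure arr arr_dim;
  obj_hausdorff : hausdorff_space obj;
  obj_second_countable : @second_countable obj;
  gsrc : arr -> obj;
  gtgt : arr -> obj;
  gunit : obj -> arr;
  ginv : arr -> arr;
  (* gmul g h is the product of g and h when gsrc g = gtgt h *)
  gmul : arr -> arr -> arr;
  gsrc_unit : forall x, gsrc (gunit x) = x;
  gtgt_unit : forall x, gtgt (gunit x) = x;
  gsrc_mul : forall g h, gsrc g = gtgt h -> gsrc (gmul g h) = gsrc h;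
  gtgt_mul : forall g h, gsrc g = gtgt h -> gtgt (gmul g h) = gtgt g;
  gmulA : forall g h k, gsrc g = gtgt h -> gsrc h = gtgt k ->
    gmul g (gmul h k) = gmul (gmul g h) k;
  gmul1 : forall g, gmul g (gunit (gsrc g)) = g;
  g1mul : forall g, gmul (gunit (gtgt g)) g = g;
  gsrc_inv : forall g, gsrc (ginv g) = gtgt g;
  gtgt_inv : forall g, gtgt (ginv g) = gsrc g;
  gmulV : forall g, gmul g (ginv g) = gunit (gtgt g);
  gVmul : forall g, gmul (ginv g) g = gunit (gsrc g);
  gsrc_submersion : submersion arr_smooth obj_smooth gsrc;
  gtgt_submersion : submersion arr_smooth obj_smooth gtgt;
  gunit_smooth : smooth_map obj_smooth arr_smooth gunit;
  ginv_smooth : smooth_map arr_smooth arr_smooth ginv;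
  gmul_smooth : forall p : 2.-tuple arr,
    gsrc (tnth p ord0) = gtgt (tnth p ord_max) ->
    smooth_map_at arr_smooth arr_smooth
      [set q : 2.-tuple arr | gsrc (tnth q ord0) = gtgt (tnth q ord_max)]
      (fun q => gmul (tnth q ord0) (tnth q ord_max)) p
}.

(* g = (g_1,...,g_k) is composable, with s(g_k) = x and t(g_1) = y; for k = 0
   this means x = y. *)
Fixpoint is_string (G : lieGroupoid) (x y : obj G) (g : seq (arr G)) : bool :=
  if g is h :: g' then (gtgt h == y) && is_string x (gsrc h) g' else x == y.

(* Finite dimensional; the grading is given by the projections onto the
   homogeneous summands, all of them zero outside the finite list gv_degs. *)
Record gradedVect := GradedVect {
  gv_space :> vectType R;
  gv_degs : seq int;
  gv_proj : int -> 'End(gv_space);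
  gv_uniq : uniq gv_degs;
  gv_supp : forall l, l \notin gv_degs -> gv_proj l = 0;
  gv_projM : forall l l',
    (gv_proj l \o gv_proj l')%VF = if l == l' then gv_proj l else 0;
  gv_sum : \sum_(l <- gv_degs) gv_proj l = \1%VF
}.

Definition has_deg (V : gradedVect) (l : int) (v : V) : Prop :=
  gv_proj V l v = v.

Definition hom_deg (V W : gradedVect) (l : int) (f : 'Hom(V, W)) : Prop :=
  forall p (v : V), has_deg p v -> has_deg (p + l) (f v).

(* v |-> (-1)^(n |v|) v *)
Definition sign_op (V : gradedVect) (n : int) : 'End(V) :=
  \sum_(p <- gv_degs V) (-1 : R) ^ (n * p) *: gv_proj V p.

Record frame (M : Type) (E : M -> gradedVect) := Frame {
  fr_dom : set M;
  fr_rank : nat;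
  fr_deg : 'I_fr_rank -> int;
  fr_sec : forall x, fr_rank.-tuple (E x)
}.

Arguments fr_deg {M E} _ _.

(* The smooth structure of a vector bundle is given by a family of smoothly
   compatible homogeneous local frames (that is, local trivialisations). *)
Record gradedBundle (M : topologicalType) (n : nat) (A : smoothStructure M n) :=
  GradedBundle {
  fibre :> M -> gradedVect;
  frames : set (frame fibre);
  frames_open : forall f, frames f -> open (fr_dom f);
  frames_basis : forall f x, frames f -> fr_dom f x ->
    basis_of fullv (fr_sec f x);
  frames_homog : forall f x i, frames f -> fr_dom f x ->
    has_deg (fr_deg f i) (tnth (fr_sec f x) i);
  frames_cover : forall x, exists2 f, frames f & fr_dom f x;
  frames_compat : forall f f' i j, frames f -> frames f' ->
    forall p, fr_dom f p -> fr_dom f' p ->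
    smooth_at A setT
      [set q : 1.-tuple M | fr_dom f (thead q) /\ fr_dom f' (thead q)]
      (fun q => coord (fr_sec f' (thead q)) i
                  (tnth (fr_sec f (thead q)) j) : R^o) [tuple p]
}.

Section Cochains.
Variable G : lieGroupoid.

Local Notation lgBundle := (gradedBundle (obj_smooth G)).

(* c x y g is the value at the string g from x to y; by convention it is 0 if g
   is not such a string (see [in_A]). *)
Definition cochain (E : obj G -> vectType R) :=
  forall x y : obj G, seq (arr G) -> 'Hom(E x, E y).

Definition bcochain (E : lgBundle) := cochain (fun x => E x).

Section Ops.
Variable E : lgBundle.

Definition smooth_cochain (k : nat) : bcochain E -> Prop :=
  match k with
  | 0 => fun c =>
      forall f f' i j, frames f -> frames f' ->
      forall p : obj G, fr_dom f p -> fr_dom f' p ->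
      smooth_at (obj_smooth G) setT
        [set q : 1.-tuple (obj G) | fr_dom f (thead q) /\ fr_dom f' (thead q)]
        (fun q => let x := thead q in
           coord (fr_sec f' x) i (c x x [::] (tnth (fr_sec f x) j)) : R^o)
        [tuple p]
  | k'.+1 => fun c =>
      let S := fun q : k'.+1.-tuple (arr G) => gsrc (tnth q ord_max) in
      let T := fun q : k'.+1.-tuple (arr G) => gtgt (tnth q ord0) in
      forall f f' i j, frames f -> frames f' ->
      forall p : k'.+1.-tuple (arr G), is_string (S p) (T p) p ->
        fr_dom f (S p) -> fr_dom f' (T p) ->
      smooth_at (arr_smooth G)
        [set q | is_string (S q) (T q) q]
        [set q | fr_dom f (S q) /\ fr_dom f' (T q)]
        (fun q => coord (fr_sec f' (T q)) i
                    (c (S q) (T q) q (tnth (fr_sec f (S q)) j)) : R^o)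
        p
  end.

(* c belongs to A_E^k(l) *)
Definition in_A (k : nat) (l : int) (c : bcochain E) : Prop :=
  [/\ forall x y g, ~~ (is_string x y g && (size g == k)) -> c x y g = 0,
      forall x y g, hom_deg l (c x y g)
    & smooth_cochain k c].

(* c o c' for c of length k; the middle object is the target of g_(k+1). *)
Definition cocirc (k : nat) (c c' : bcochain E) : bcochain E := fun x y g =>
  let z := if drop k g is h :: _ then gtgt h else x in
  (c z y (take k g) \o c' x z (drop k g))%VF.

(* (g_1,...,g_k) |-> c (g_1,...,g_i g_(i+1),...,g_k) *)
Definition coface (i : nat) (c : bcochain E) : bcochain E := fun x y g =>
  if is_string x y g then
    if drop i.-1 g is h1 :: h2 :: r
    then c x y (take i.-1 g ++ gmul h1 h2 :: r) else 0
  else 0.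

Definition cobdry (R0 : bcochain E) (l : int) (c : bcochain E) : bcochain E :=
  fun x y g => (R0 y y [::] \o c x y g)%VF
    - (-1 : R) ^ l *: (c x y g \o R0 x x [::])%VF.

End Ops.

Record ruth := Ruth {
  ruth_bundle :> lgBundle;
  ruth_op : nat -> bcochain ruth_bundle;
  ruth_in_A : forall k, in_A k (1 - k%:Z) (ruth_op k);
  ruth_eq : forall k x y g, is_string x y g -> size g = k ->
    \sum_(1 <= j < k) (-1 : R) ^+ j *: coface j (ruth_op k.-1) x y g =
    \sum_(j < k.+1) (-1 : R) ^+ j *:
      cocirc j (ruth_op j) (ruth_op (k - j)%N) x y g
}.

Definition unital_ops (E : obj G -> vectType R) (r : nat -> cochain E) : Prop :=
  (forall x, r 1%N x x [:: gunit x] = \1%VF) /\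
  (forall k x y g, (2 <= k)%N -> is_string x y g -> size g = k ->
     (exists z, gunit z \in g) -> r k x y g = 0).

Definition unital (E : ruth) : Prop := unital_ops (ruth_op E).

Definition is_char_map (E : ruth) (kE : Omega R -> bcochain E) : Prop :=
  [/\ forall (a : R) u v x y g,
        kE (a *: u + v) x y g = a *: kE u x y g + kE v x y g,
      forall k l u, homog k l u -> in_A k l (kE u),
      forall k l k' l' u v, homog k l u -> homog k' l' v ->
        kE (circ u v) = cocirc k (kE u) (kE v),
      forall k l u, homog k l u ->
        kE (bdry u) = cobdry (ruth_op E 0) l (kE u)
    & (forall k l i u, homog k l u -> (1 <= i <= k)%N ->
         kE (face i u) = coface i (kE u))
      /\ (forall n, (1 <= n)%N -> kE (Lgen R n) = ruth_op E n)].

End Cochains.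

Section Tensor.
Variable m : nat.

(* V_1 (x) ... (x) V_m, as the space of coordinates with respect to the tensor
   products of the basis vectors of the V_i *)
Definition tensor (V : 'I_m -> vectType R) : vectType R :=
  {ffun {dffun forall i : 'I_m, 'I_(\dim {: V i})} -> R^o}.

Definition tpure (V : 'I_m -> vectType R) (v : forall i, V i) : tensor V :=
  [ffun I : {dffun forall i : 'I_m, 'I_(\dim {: V i})} =>
    \prod_(i < m) coord (vbasis {: V i}) (I i) (v i)].

(* The linear map with tpure v |-> tpure (f v) *)
Definition tmap (V W : 'I_m -> vectType R) (f : forall i, 'Hom(V i, W i)) :
    'Hom(tensor V, tensor W) :=
  linfun (fun t : tensor V =>
    \sum_(I : {dffun forall i : 'I_m, 'I_(\dim {: V i})})
      (t I : R) *: tpure (fun i => f i (tnth (vbasis {: V i}) (I i)))).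

(* Koszul tensor product of maps f_i of degree l_i:
   v_1 (x) ... (x) v_m |-> (-1)^(sum_(j < i) l_i |v_j|) f_1 v_1 (x) ... (x) f_m v_m *)
Definition ktmap (V W : 'I_m -> gradedVect) (l : 'I_m -> int)
    (f : forall i, 'Hom(V i, W i)) : 'Hom(tensor V, tensor W) :=
  tmap (fun j => (f j \o sign_op (V j) (\sum_(i < m | (j < i)%N) l i))%VF).

Variables (G : lieGroupoid) (E : 'I_m -> ruth G).

Definition tensor_fibre (x : obj G) : vectType R := tensor (fun i => E i x).

(* The identity of the fibre if x = y, and 0 otherwise *)
Definition id_hom (F : obj G -> gradedVect) (x y : obj G) : 'Hom(F x, F y) :=
  if pselect (x = y) is left e
  then ecast z 'Hom(F x, F z) e \1%VF else 0.

Definition tensor_op (om : bar R m)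
    (kE : forall i, Omega R -> bcochain (E i)) (n : nat) : cochain tensor_fibre :=
  fun x y g =>
  if n == 0%N then
    \sum_(i < m)
      ktmap (fun j => if j == i then 1 else 0)
            (fun j => if j == i then ruth_op (E j) 0 x y g
                      else id_hom (E j) x y)
  else
    \sum_(W <- msupp (om n)) (om n)@_W *:
      ktmap (fun i => - (nb (tnth W i))%:Z)
            (fun i => kE i (bas R (tnth W i)) x y g).

End Tensor.

End Smooth.

(* Main.v *)
Require Import Defs.
From HB Require Import structures.
From mathcomp Require Import all_boot all_order all_algebra all_fingroup.
From mathcomp Require Import finmap monalg ring zify.
From mathcomp Require Import all_classical all_reals all_analysis.

Set Implicit Arguments.
Unset Strict Implicit.
Unset Printing Implicit Defensive.

Import Order.TTheory GRing.Theory Num.Theory.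

Local Open Scope classical_set_scope.
Local Open Scope ring_scope.

(** Word letters are cells of the interval: [La] and [Lc] are its end points and
    [Lb] is the edge between them, with boundary c - a.

    The words b^n generate all words, since inserting [La] is a face and
    inserting [Lc] is a composition; a map commuting with both is determined by
    its values on the b^n ([is_Delta_unique]). Given x of bidegree (2,-1) with
    boundary c - a (diagonal letters), the unital algebra map a, b, c |-> a, x, c
    commutes with faces, compositions and, by the Leibniz rule of the box power
    ([mbdry_mdia]), with the boundary. So it is the Delta of the sequence of its
    values x^n on the b^n, which is therefore rigid; the Maurer-Cartan equation
    for that sequence is the image of the formula for the boundary of b^n
    ([bdry_word_nseq]). Conversely, if omega is rigid with omega_2 = x, then
    multiplicativity of Delta forces omega_(n+1) = x^n, and compatibility with
    the boundary, applied to b, gives the boundary of x ([rigid_geom]).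

    An element of bidegree (2,-1) is a 1-chain on the m-cube, and the boundary is
    the cellular one. The rigid elements are thus the 1-chains going from the
    vertex (a,...,a) to the vertex (c,...,c). A flow distributing a unit mass
    uniformly over the maximal paths is a symmetric one ([Rset_sym_edges]). The
    difference of two symmetric ones is a symmetric cycle; its coefficients
    depend only on the height in the cube, and vanish by induction on this height
    ([sym_cycle_eq0]). Permutations of the factors respect the product
    ([mperm_mdia]), so symmetry of x and of its geometric series are equivalent.

    For unitality, consider a string whose i-th arrow is a unit, and the letters
    of a word on the two sides of this arrow. Under a unital characteristic map,
    exchanging these letters does not change the value ([char_unit_swap]), and
    the value is 0 if both are b ([char_unit_vanish]). Since x has odd degree,
    exchanging two adjacent factors of x^n costs a sign, so that the terms of R_n
    cancel ([lsum_square_eq0]): at a unit, x squares to zero as an odd element of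
    a graded commutative algebra. If the unit is the first or the last arrow, each
    term vanishes, because each factor x puts a b in one of the tensor
    components. *)

(* Elements of free modules are handled through coefficients and linearity only. *)
Opaque mkmalgU fgadd fgscale fgopp fgzero.

(** * Linear extension from a basis *)

Section FreeModule.
Variables (R : realType) (K : choiceType).
Implicit Types x y : {malg R[K]}.

Lemma malgUZ (c : R) (k : K) : << c *g k >> = c *: << k >> :> {malg R[K]}.
Proof.
by apply/malgP => k'; rewrite mcoeffZ !mcoeffU mulr_natr.
Qed.

Lemma mcoeff_sum (I : Type) (r : seq I) (P : pred I) (F : I -> {malg R[K]}) k :
  (\sum_(i <- r | P i) F i)@_k = \sum_(i <- r | P i) (F i)@_k.
Proof. exact: raddf_sum. Qed.

Lemma malg_sum_basis x : x = \sum_(k <- msupp x) x@_k *: << k >>.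
Proof. by rewrite {1}[x]monalgE; apply: eq_bigr => k _; rewrite malgUZ. Qed.

Variable V : lmodType R.

(** [lin_ext] for values in any module, such as a space of linear maps. *)
Definition lsum (f : K -> V) x : V := \sum_(k <- msupp x) x@_k *: f k.

Lemma lsum_wide (f : K -> V) x (d : {fset K}) :
  (msupp x `<=` d)%fset -> lsum f x = \sum_(k <- d) x@_k *: f k.
Proof.
move=> xd; rewrite /lsum (big_fset_incl _ xd) // => k _ kx.
by rewrite mcoeff_outdom ?scale0r.
Qed.

Lemma lsum_is_linear (f : K -> V) : linear (lsum f).
Proof.
move=> c x y; pose d := (msupp x `|` msupp y `|` msupp (c *: x + y))%fset.
rewrite !(@lsum_wide f _ d).
- rewrite scaler_sumr -big_split; apply: eq_bigr => k _ /=.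
  by rewrite mcoeffD mcoeffZ scalerDl scalerA.
- by rewrite /d -fsetUA fsubsetU // orbC fsubsetU // fsubset_refl.
- by rewrite /d -fsetUA fsubsetU // fsubset_refl.
- by rewrite /d fsubsetU // fsubset_refl orbT.
Qed.

HB.instance Definition _ f :=
  GRing.isLinear.Build R {malg R[K]} V *:%R (lsum f) (lsum_is_linear f).

Lemma lsumU f k : lsum f << k >> = f k.
Proof. by rewrite /lsum msuppU oner_eq0 big_seq_fset1 mcoeffUU scale1r. Qed.

Lemma linear_sum_basis (F : {malg R[K]} -> V) x :
  linear F -> F x = \sum_(k <- msupp x) x@_k *: F << k >>.
Proof.
move=> lF; pose L : {linear {malg R[K]} -> V} :=
  HB.pack F (GRing.isLinear.Build R {malg R[K]} V *:%R F lF).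
rewrite -[LHS]/(L x) {1}(malg_sum_basis x) linear_sum.
by apply: eq_bigr => k _; rewrite linearZ.
Qed.

Lemma linear_ext (F G : {malg R[K]} -> V) x :
  linear F -> linear G -> (forall k, k \in msupp x -> F << k >> = G << k >>) ->
  F x = G x.
Proof.
move=> lF lG FG; rewrite (linear_sum_basis x lF) (linear_sum_basis x lG).
by rewrite !big_seq; apply: eq_bigr => k /FG ->.
Qed.

End FreeModule.

(** Supports are kept in the hypotheses on basis vectors so that identities
    holding up to a sign depending on degrees can be proved for homogeneous
    elements. *)
Lemma bilinear_ext (R : realType) (K1 K2 : choiceType) (V : lmodType R)
    (F G : {malg R[K1]} -> {malg R[K2]} -> V) x y :
  (forall v, linear (F^~ v)) -> (forall u, linear (F u)) ->
  (forall v, linear (G^~ v)) -> (forall u, linear (G u)) ->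
  (forall u v, u \in msupp x -> v \in msupp y ->
     F << u >> << v >> = G << u >> << v >>) ->
  F x y = G x y.
Proof.
move=> lF1 lF2 lG1 lG2 FG.
rewrite (linear_sum_basis x (lF1 y)) (linear_sum_basis x (lG1 y)).
rewrite !big_seq; apply: eq_bigr => u ux; congr (_ *: _).
rewrite (linear_sum_basis y (lF2 _)) (linear_sum_basis y (lG2 _)).
by rewrite !big_seq; apply: eq_bigr => v vy; congr (_ *: _); exact: FG.
Qed.

Lemma trilinear_ext (R : realType) (K1 K2 K3 : choiceType) (V : lmodType R)
    (F G : {malg R[K1]} -> {malg R[K2]} -> {malg R[K3]} -> V) x y z :
  (forall v w, linear (fun u => F u v w)) ->
  (forall u w, linear (fun v => F u v w)) -> (forall u v, linear (F u v)) ->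
  (forall v w, linear (fun u => G u v w)) ->
  (forall u w, linear (fun v => G u v w)) -> (forall u v, linear (G u v)) ->
  (forall u v w, F << u >> << v >> << w >> = G << u >> << v >> << w >>) ->
  F x y z = G x y z.
Proof.
move=> lF1 lF2 lF3 lG1 lG2 lG3 FG.
rewrite (linear_sum_basis x (lF1 y z)) (linear_sum_basis x (lG1 y z)).
apply: eq_bigr => u _; congr (_ *: _).
apply: (bilinear_ext (F := F _) (G := G _)) => // v w _ _; exact: FG.
Qed.

Section LinearOperators.
Variable R : realType.

HB.instance Definition _ (K K1 : choiceType) (f : K1 -> {malg R[K]}) :=
  GRing.isLinear.Build R {malg R[K1]} {malg R[K]} *:%R (lin_ext f)
    (lsum_is_linear f).

Lemma lin_extE (K K1 : choiceType) (f : K1 -> {malg R[K]}) x :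
  lin_ext f x = lsum f x.
Proof. by []. Qed.

Lemma lin_extU (K K1 : choiceType) (f : K1 -> {malg R[K]}) k :
  lin_ext f << k >> = f k.
Proof. exact: lsumU. Qed.

Lemma bilin_extE (K K1 K2 : choiceType) (f : K1 -> K2 -> {malg R[K]}) x y :
  bilin_ext f x y = lin_ext (fun u => lin_ext (f u) y) x.
Proof.
apply: eq_bigr => u _; rewrite scaler_sumr; apply: eq_bigr => v _.
by rewrite scalerA.
Qed.

Lemma bilin_extUU (K K1 K2 : choiceType) (f : K1 -> K2 -> {malg R[K]}) u v :
  bilin_ext f << u >> << v >> = f u v.
Proof. by rewrite bilin_extE !lin_extU. Qed.

Lemma bilin_ext_is_bilinear (K K1 K2 : choiceType)
    (f : K1 -> K2 -> {malg R[K]}) :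
  bilinear_for *:%R *:%R (bilin_ext f).
Proof.
split=> z c x y /=; first by rewrite !bilin_extE linearP.
rewrite !bilin_extE {1}/lin_ext scaler_sumr -big_split.
by apply: eq_bigr => u _; rewrite linearP scalerDr !scalerA mulrC.
Qed.

HB.instance Definition _ (K K1 K2 : choiceType)
    (f : K1 -> K2 -> {malg R[K]}) :=
  bilinear_isBilinear.Build R {malg R[K1]} {malg R[K2]} {malg R[K]} *:%R *:%R
    (bilin_ext f) (bilin_ext_is_bilinear f).

Section BilinearRules.
Variables (K K1 K2 : choiceType) (f : K1 -> K2 -> {malg R[K]}).

Lemma bilin_extPl c x y z : bilin_ext f (c *: x + y) z = c *: bilin_ext f x z + bilin_ext f y z.
Proof. by rewrite linearPl. Qed.
Lemma bilin_extPr c x y z : bilin_ext f z (c *: x + y) = c *: bilin_ext f z x + bilin_ext f z y.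
Proof. by rewrite linearPr. Qed.
Lemma bilin_extDl x y z : bilin_ext f (x + y) z = bilin_ext f x z + bilin_ext f y z.
Proof. exact: linearDl. Qed.
Lemma bilin_extDr x y z : bilin_ext f z (x + y) = bilin_ext f z x + bilin_ext f z y.
Proof. exact: linearDr. Qed.
Lemma bilin_extBl x y z : bilin_ext f (x - y) z = bilin_ext f x z - bilin_ext f y z.
Proof. exact: linearBl. Qed.
Lemma bilin_extBr x y z : bilin_ext f z (x - y) = bilin_ext f z x - bilin_ext f z y.
Proof. exact: linearBr. Qed.
Lemma bilin_extZl c x z : bilin_ext f (c *: x) z = c *: bilin_ext f x z.
Proof. exact: linearZl_LR. Qed.
Lemma bilin_extZr c x z : bilin_ext f z (c *: x) = c *: bilin_ext f z x.
Proof. exact: linearZr_LR. Qed.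
Lemma bilin_ext0l z : bilin_ext f 0 z = 0.
Proof. exact: linear0l. Qed.
Lemma bilin_ext0r z : bilin_ext f z 0 = 0.
Proof. exact: linear0r. Qed.
Lemma bilin_ext_suml (I : Type) (r : seq I) (P : pred I) F z :
  bilin_ext f (\sum_(i <- r | P i) F i) z = \sum_(i <- r | P i) bilin_ext f (F i) z.
Proof. exact: linear_sumlz. Qed.
Lemma bilin_ext_sumr (I : Type) (r : seq I) (P : pred I) F z :
  bilin_ext f z (\sum_(i <- r | P i) F i) = \sum_(i <- r | P i) bilin_ext f z (F i).
Proof. exact: linear_sumr. Qed.

End BilinearRules.

Lemma diaPl c x y z : @dia R (c *: x + y) z = c *: @dia R x z + @dia R y z.
Proof. exact: bilin_extPl. Qed.
Lemma diaPr c x y z : @dia R z (c *: x + y) = c *: @dia R z x + @dia R z y.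
Proof. exact: bilin_extPr. Qed.
Lemma diaDl x y z : @dia R (x + y) z = @dia R x z + @dia R y z.
Proof. exact: bilin_extDl. Qed.
Lemma diaDr x y z : @dia R z (x + y) = @dia R z x + @dia R z y.
Proof. exact: bilin_extDr. Qed.
Lemma diaBl x y z : @dia R (x - y) z = @dia R x z - @dia R y z.
Proof. exact: bilin_extBl. Qed.
Lemma diaBr x y z : @dia R z (x - y) = @dia R z x - @dia R z y.
Proof. exact: bilin_extBr. Qed.
Lemma diaZl c x z : @dia R (c *: x) z = c *: @dia R x z.
Proof. exact: bilin_extZl. Qed.
Lemma diaZr c x z : @dia R z (c *: x) = c *: @dia R z x.
Proof. exact: bilin_extZr. Qed.
Lemma dia0l z : @dia R 0 z = 0.
Proof. exact: bilin_ext0l. Qed.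
Lemma dia0r z : @dia R z 0 = 0.
Proof. exact: bilin_ext0r. Qed.
Lemma dia_sumr (I : Type) (r : seq I) (P : pred I) F z :
  @dia R z (\sum_(i <- r | P i) F i) = \sum_(i <- r | P i) @dia R z (F i).
Proof. exact: bilin_ext_sumr. Qed.

Lemma dia_bas u v : dia (bas R u) (bas R v) = bas R (u ++ v).
Proof. exact: bilin_extUU. Qed.

Variable m : nat.

Lemma mdiaPl c x y z : @mdia R m (c *: x + y) z = c *: @mdia R m x z + @mdia R m y z.
Proof. exact: bilin_extPl. Qed.
Lemma mdiaPr c x y z : @mdia R m z (c *: x + y) = c *: @mdia R m z x + @mdia R m z y.
Proof. exact: bilin_extPr. Qed.
Lemma mdiaZl c x z : @mdia R m (c *: x) z = c *: @mdia R m x z.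
Proof. exact: bilin_extZl. Qed.
Lemma mdiaZr c x z : @mdia R m z (c *: x) = c *: @mdia R m z x.
Proof. exact: bilin_extZr. Qed.
Lemma mdia_suml (I : Type) (r : seq I) (P : pred I) F z :
  @mdia R m (\sum_(i <- r | P i) F i) z = \sum_(i <- r | P i) @mdia R m (F i) z.
Proof. exact: bilin_ext_suml. Qed.
Lemma mdia_sumr (I : Type) (r : seq I) (P : pred I) F z :
  @mdia R m z (\sum_(i <- r | P i) F i) = \sum_(i <- r | P i) @mdia R m z (F i).
Proof. exact: bilin_ext_sumr. Qed.

Lemma diaE (x y : Omega R) :
  dia x y = bilin_ext (fun u v : word => bas R (u ++ v)) x y.
Proof. by []. Qed.

Lemma mdiaE (x y : OmegaM R m) : mdia x y =
  bilin_ext (fun U V : mword m => shuffle_sign R U V *: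
    mbas R [tuple tnth U i ++ tnth V i | i < m]) x y.
Proof. by []. Qed.

Lemma mcircPl c x y z :
  @mcirc R m (c *: x + y) z = c *: @mcirc R m x z + @mcirc R m y z.
Proof. exact: bilin_extPl. Qed.
Lemma mcircPr c x y z :
  @mcirc R m z (c *: x + y) = c *: @mcirc R m z x + @mcirc R m z y.
Proof. exact: bilin_extPr. Qed.

Lemma mcirc0l z : @mcirc R m 0 z = 0.
Proof. exact: bilin_ext0l. Qed.
Lemma mcirc0r z : @mcirc R m z 0 = 0.
Proof. exact: bilin_ext0r. Qed.

Lemma mcirc_bas (U V : mword m) : mcirc (mbas R U) (mbas R V) =
  shuffle_sign R U V *: mbas R [tuple tnth U i ++ Lc :: tnth V i | i < m].
Proof. exact: bilin_extUU. Qed.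

HB.instance Definition _ := GRing.Linear.copy (@bdry R) (lin_ext (@bdry_word R)).
HB.instance Definition _ i := GRing.Linear.copy (@face R i)
  (lin_ext (fun w => bas R (face_word i w))).
HB.instance Definition _ i := GRing.Linear.copy (@mface R m i)
  (lin_ext (fun W : mword m =>
    mbas R [tuple face_word i (tnth W j) | j < m])).
HB.instance Definition _ (W : mword m) i :=
  GRing.Linear.copy (@replace_factor R m W i)
  (lin_ext (fun w : word =>
    mbas R [tuple if j == i then w else tnth W j | j < m])).
HB.instance Definition _ := GRing.Linear.copy (@mbdry R m)
  (lin_ext (fun W : mword m => \sum_(i < m)
    (-1) ^+ (\sum_(j < m | (j < i)%N) nb (tnth W j))%N *:
      replace_factor W i (bdry_word R (tnth W i)))).
HB.instance Definition _ s := GRing.Linear.copy (@mperm R m s)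
  (lin_ext (fun W : mword m =>
    ((-1) ^+ (\sum_(i < m) \sum_(j < m | ((i < j) && (s j < s i))%N)
                nb (tnth W (s i)) * nb (tnth W (s j)))%N : R) *:
      mbas R [tuple tnth W (s i) | i < m])).

End LinearOperators.

Opaque lin_ext bilin_ext dia mdia mcirc.

(** * Supports *)

Section Support.
Variables (R : realType) (K : choiceType).

Definition supported (P : K -> Prop) (x : {malg R[K]}) : Prop :=
  forall k, k \in msupp x -> P k.

Lemma supported0 P : supported P 0.
Proof. by move=> k; rewrite msupp0. Qed.

Lemma supportedD P x y : supported P x -> supported P y -> supported P (x + y).
Proof.
by move=> Px Py k /(fsubsetP (msuppD_le _ _)); rewrite in_fsetU => /orP[/Px|/Py].
Qed.

Lemma supportedZ P (c : R) x : supported P x -> supported P (c *: x).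
Proof. by move=> Px k /(fsubsetP (msuppZ_le _ _)) /Px. Qed.

Lemma supportedU (P : K -> Prop) k : P k -> supported P << k >>.
Proof.
by move=> Pk k'; rewrite msuppU oner_eq0 in_fset1 => /eqP ->.
Qed.

Lemma supported_sum P (I : Type) (r : seq I) (Q : pred I)
    (F : I -> {malg R[K]}) :
  (forall i, Q i -> supported P (F i)) -> supported P (\sum_(i <- r | Q i) F i).
Proof.
by move=> PF; elim/big_rec: _ => [|i x /PF]; [exact: supported0|exact: supportedD].
Qed.

Lemma supported_weaken (P Q : K -> Prop) x :
  (forall k, P k -> Q k) -> supported P x -> supported Q x.
Proof. by move=> PQ Px k /Px /PQ. Qed.

End Support.

Lemma supported_lin_ext (R : realType) (K K1 : choiceType) (P : K -> Prop)
    (Q : K1 -> Prop) (f : K1 -> {malg R[K]}) x :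
  supported Q x -> (forall k, Q k -> supported P (f k)) -> supported P (lin_ext f x).
Proof.
move=> Qx Pf; rewrite lin_extE /lsum big_seq; apply: supported_sum => k /Qx /Pf.
exact: supportedZ.
Qed.

Lemma supported_bilin_ext (R : realType) (K K1 K2 : choiceType) (P : K -> Prop)
    (P1 : K1 -> Prop) (P2 : K2 -> Prop) (f : K1 -> K2 -> {malg R[K]}) x y :
  supported P1 x -> supported P2 y ->
  (forall u v, P1 u -> P2 v -> supported P (f u v)) ->
  supported P (bilin_ext f x y).
Proof.
move=> Px Py Pf; rewrite bilin_extE; apply: supported_lin_ext Px _ => u Pu.
by apply: supported_lin_ext Py _ => v; exact: Pf.
Qed.

(** * The word algebra *)

Section WordAlgebra.
Variable R : realType.
Local Notation bas := (bas R).

Lemma nb_cat u v : nb (u ++ v) = (nb u + nb v)%N.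
Proof. exact: count_cat. Qed.

Lemma diaA : associative (@dia R).
Proof.
move=> x y z.
apply: (trilinear_ext (F := fun x y z => dia x (dia y z))
  (G := fun x y z => dia (dia x y) z)) => [v w|u w|u v|v w|u w|u v|u v w].
- by move=> c a b; rewrite diaPl.
- by move=> c a b; rewrite diaPl diaPr.
- by move=> c a b; rewrite 2!diaPr.
- by move=> c a b; rewrite 2!diaPl.
- by move=> c a b; rewrite diaPr diaPl.
- by move=> c a b; rewrite diaPr.
- by rewrite 4!dia_bas catA.
Qed.

Lemma dia1l x : dia (bas [::]) x = x.
Proof.
rewrite [RHS](malg_sum_basis x) {1}(malg_sum_basis x) dia_sumr.
by apply: eq_bigr => u _; rewrite diaZr dia_bas.
Qed.

Lemma bdry_bas w : bdry (bas w) = bdry_word R w.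
Proof. exact: lin_extU. Qed.

Lemma bdry_word_supp w :
  supported (fun v => size v = size w /\ (nb v).+1 = nb w) (bdry_word R w).
Proof.
elim: w => [|x w IHw] /=; first exact: supported0.
apply: supportedD.
  rewrite /bdry_letter; case: eqVneq => _; last first.
    by rewrite dia0l; exact: supported0.
  rewrite diaBl -scaleN1r 2!dia_bas; apply: supportedD.
    exact: supportedU.
  by apply: supportedZ; exact: supportedU.
rewrite diaE; apply: supportedZ; apply: supported_bilin_ext (supportedU (P := eq [:: x]) _) IHw _.
  by [].
move=> u v <- [sv nv]; apply: supportedU => /=.
by rewrite sv -nv /nb /= addnS.
Qed.

Lemma bdry_word_cons x w : bdry_word R (x :: w) =
  dia (bdry_letter R x) (bas w)
    + (-1) ^+ nb [:: x] *: dia (bas [:: x]) (bdry_word R w).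
Proof. by []. Qed.

Lemma bdry_word_cat u v : bdry_word R (u ++ v) =
  dia (bdry_word R u) (bas v) + (-1) ^+ nb u *: dia (bas u) (bdry_word R v).
Proof.
elim: u => [|x u IHu]; first by rewrite dia0l add0r expr0 scale1r dia1l.
rewrite cat_cons !bdry_word_cons {}IHu !(diaDl, diaDr, diaZl, diaZr) scalerDr.
rewrite -!diaA dia_bas scalerA -exprD -nb_cat addrA.
by rewrite (diaA (bas [:: x]) (bas u)) dia_bas cat1s.
Qed.

End WordAlgebra.

(** * The m-fold box power *)

Section BoxPower.
Variables (R : realType) (m : nat).
Local Notation mword := (mword m).
Local Notation mbas := (mbas R).

Definition mcat (U V : mword) : mword := [tuple tnth U i ++ tnth V i | i < m].

Lemma tnth_mcat U V i : tnth (mcat U V) i = tnth U i ++ tnth V i.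
Proof. exact: tnth_mktuple. Qed.

Lemma mcatA : associative mcat.
Proof. by move=> U V W; apply: eq_from_tnth => i; rewrite !tnth_mcat catA. Qed.

Lemma mcat1l U : mcat [tuple [::] | _ < m] U = U.
Proof. by apply: eq_from_tnth => i; rewrite tnth_mcat tnth_mktuple. Qed.

Lemma mcat1r U : mcat U [tuple [::] | _ < m] = U.
Proof. by apply: eq_from_tnth => i; rewrite tnth_mcat tnth_mktuple cats0. Qed.

Lemma mnb_cat U V : mnb (mcat U V) = (mnb U + mnb V)%N.
Proof.
by rewrite /mnb -big_split; apply: eq_bigr => i _; rewrite tnth_mcat nb_cat.
Qed.

Lemma scale_mbas_congr (c c' : R) (U V : mword) :
  c = c' -> U = V -> c *: mbas U = c' *: mbas V.
Proof. by move=> -> ->. Qed.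

Lemma mdia_bas U V :
  mdia (mbas U) (mbas V) = shuffle_sign R U V *: mbas (mcat U V).
Proof. by rewrite mdiaE bilin_extUU. Qed.

(** The exponent of [shuffle_sign], as a function of the numbers of b's: all
    signs below are compared through its biadditivity. *)
Definition shuffle_exp (f g : 'I_m -> nat) : nat :=
  (\sum_(i < m) \sum_(j < m | j < i) f i * g j)%N.

Lemma shuffle_signE U V :
  shuffle_sign R U V =
  (-1) ^+ shuffle_exp (fun i => nb (tnth U i)) (fun i => nb (tnth V i)).
Proof. by []. Qed.

Lemma eq_shuffle_exp f f' g g' : f =1 f' -> g =1 g' ->
  shuffle_exp f g = shuffle_exp f' g'.
Proof.
move=> ff gg; apply: eq_bigr => i _; apply: eq_bigr => j _.
by rewrite ff gg.
Qed.

Lemma shuffle_expDl f f' g :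
  shuffle_exp (fun i => f i + f' i)%N g = (shuffle_exp f g + shuffle_exp f' g)%N.
Proof.
rewrite /shuffle_exp -big_split; apply: eq_bigr => i _ /=.
by rewrite -big_split; apply: eq_bigr => j _; rewrite mulnDl.
Qed.

Lemma shuffle_expDr f g g' :
  shuffle_exp f (fun i => g i + g' i)%N = (shuffle_exp f g + shuffle_exp f g')%N.
Proof.
rewrite /shuffle_exp -big_split; apply: eq_bigr => i _ /=.
by rewrite -big_split; apply: eq_bigr => j _; rewrite mulnDr.
Qed.

Lemma shuffle_exp0l g : shuffle_exp (fun=> 0%N) g = 0%N.
Proof. by rewrite /shuffle_exp big1 // => i _; rewrite big1. Qed.

Lemma shuffle_exp0r f : shuffle_exp f (fun=> 0%N) = 0%N.
Proof. by rewrite /shuffle_exp big1 // => i _; rewrite big1 // => j _; rewrite muln0. Qed.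

Lemma shuffle_exp_deltal (p : 'I_m) g :
  shuffle_exp (fun i => (i == p) : nat) g = (\sum_(j < m | j < p) g j)%N.
Proof.
rewrite /shuffle_exp (bigD1 p) //= [X in (_ + X)%N]big1 ?addn0.
  by apply: eq_bigr => j _; rewrite eqxx mul1n.
by move=> i /negPf ->; rewrite big1.
Qed.

Lemma shuffle_exp_deltar f (p : 'I_m) :
  shuffle_exp f (fun i => (i == p) : nat) = (\sum_(i < m | p < i) f i)%N.
Proof.
rewrite /shuffle_exp [RHS]big_mkcond; apply: eq_bigr => i _ /=.
case: ifP => pi.
  rewrite (bigD1 p) //= eqxx muln1 big1 ?addn0 // => j /andP[_ /negPf ->].
  by rewrite muln0.
by rewrite big1 // => j ji; case: eqP => [jp|]; [rewrite jp pi in ji|rewrite muln0].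
Qed.

Lemma shuffle_sign_catl U V W :
  shuffle_sign R (mcat U V) W = shuffle_sign R U W * shuffle_sign R V W.
Proof.
rewrite !shuffle_signE -exprD -shuffle_expDl; congr (_ ^+ _).
by apply: eq_shuffle_exp => i //; rewrite tnth_mcat nb_cat.
Qed.

Lemma shuffle_sign_catr U V W :
  shuffle_sign R U (mcat V W) = shuffle_sign R U V * shuffle_sign R U W.
Proof.
rewrite !shuffle_signE -exprD -shuffle_expDr; congr (_ ^+ _).
by apply: eq_shuffle_exp => i //; rewrite tnth_mcat nb_cat.
Qed.

Lemma shuffle_sign_nb0l (U V : mword) :
  (forall i, nb (tnth U i) = 0%N) -> shuffle_sign R U V = 1.
Proof.
move=> U0; rewrite shuffle_signE (@eq_shuffle_exp _ _ _ _ U0 (frefl _)).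
by rewrite shuffle_exp0l.
Qed.

Lemma shuffle_sign_nb0r (U V : mword) :
  (forall i, nb (tnth V i) = 0%N) -> shuffle_sign R U V = 1.
Proof.
move=> V0; rewrite shuffle_signE (@eq_shuffle_exp _ _ _ _ (frefl _) V0).
by rewrite shuffle_exp0r.
Qed.

Lemma mdiaA : associative (@mdia R m).
Proof.
move=> x y z.
apply: (trilinear_ext (F := fun x y z => mdia x (mdia y z))
  (G := fun x y z => mdia (mdia x y) z)) => [v w|u w|u v|v w|u w|u v|U V W].
- by move=> c a b; rewrite mdiaPl.
- by move=> c a b; rewrite mdiaPl mdiaPr.
- by move=> c a b; rewrite 2!mdiaPr.
- by move=> c a b; rewrite 2!mdiaPl.
- by move=> c a b; rewrite mdiaPr mdiaPl.
- by move=> c a b; rewrite mdiaPr.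
rewrite 2!mdia_bas mdiaZl mdiaZr 2!mdia_bas 2!scalerA mcatA.
by rewrite shuffle_sign_catl shuffle_sign_catr mulrC mulrA.
Qed.

Lemma mdia_diag_bas w U : nb w = 0%N ->
  mdia (mdiag R m w) (mbas U) = mbas (mcat [tuple w | _ < m] U).
Proof.
move=> w0; rewrite mdia_bas shuffle_sign_nb0l => [|i].
  by rewrite scale1r.
by rewrite tnth_mktuple.
Qed.

Lemma mdia_bas_diag w U : nb w = 0%N ->
  mdia (mbas U) (mdiag R m w) = mbas (mcat U [tuple w | _ < m]).
Proof.
move=> w0; rewrite mdia_bas shuffle_sign_nb0r => [|i].
  by rewrite scale1r.
by rewrite tnth_mktuple.
Qed.

Lemma mdia1l x : mdia (mdiag R m [::]) x = x.
Proof.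
rewrite [RHS](malg_sum_basis x) {1}(malg_sum_basis x) mdia_sumr.
apply: eq_bigr => U _.
by rewrite mdiaZr (mdia_diag_bas (w := [::]) U erefl) mcat1l.
Qed.

Lemma mdia1r x : mdia x (mdiag R m [::]) = x.
Proof.
rewrite [RHS](malg_sum_basis x) {1}(malg_sum_basis x) mdia_suml.
apply: eq_bigr => U _.
by rewrite mdiaZl (mdia_bas_diag (w := [::]) U erefl) mcat1r.
Qed.

Lemma mcircE x y : mcirc x y = mdia (mdia x (mdiag R m [:: Lc])) y.
Proof.
apply: (bilinear_ext (F := @mcirc R m)
  (G := fun x y => mdia (mdia x (mdiag R m [:: Lc])) y)) => [v|u|v|u|U V _ _].
- by move=> c a b; rewrite mcircPl.
- by move=> c a b; rewrite mcircPr.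
- by move=> c a b; rewrite 2!mdiaPl.
- by move=> c a b; rewrite mdiaPr.
rewrite (mdia_bas_diag (w := [:: Lc]) U erefl) mdia_bas mcirc_bas.
rewrite shuffle_sign_catl [X in _ * X]shuffle_sign_nb0l => [|i].
  rewrite mulr1; apply: scale_mbas_congr => //; apply: eq_from_tnth => i.
  by rewrite !tnth_mktuple -catA.
by rewrite tnth_mktuple.
Qed.

Lemma supported_mdia (P Q S : mword -> Prop) (x y : OmegaM R m) :
  supported P x -> supported Q y ->
  (forall U V, P U -> Q V -> S (mcat U V)) -> supported S (mdia x y).
Proof.
move=> Px Qy PQS; rewrite mdiaE; apply: supported_bilin_ext Px Qy _ => U V PU QV.
by apply: supportedZ; apply: supportedU; exact: PQS.
Qed.

Lemma mhomogD k l x y :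
  @mhomog R m k l x -> @mhomog R m k l y -> @mhomog R m k l (x + y).
Proof. exact: supportedD. Qed.

Lemma mhomogZ k l c x : @mhomog R m k l x -> @mhomog R m k l (c *: x).
Proof. exact: supportedZ. Qed.

Lemma mhomog_mdia k l k' l' x y :
  @mhomog R m k.+1 l x -> @mhomog R m k'.+1 l' y ->
  @mhomog R m (k + k').+1 (l + l') (mdia x y).
Proof.
move=> hx hy; apply: (supported_mdia hx hy) => U V [sU nU] [sV nV]; split.
  move=> i; rewrite tnth_mcat size_cat.
  by case: (sU i) => ->; case: (sV i) => ->.
by rewrite mnb_cat PoszD opprD nU nV.
Qed.

Lemma mhomog_diag w : nb w = 0%N -> @mhomog R m (size w).+1 0 (mdiag R m w).
Proof.
move=> w0; apply: supportedU; split=> [i|]; first by rewrite tnth_mktuple.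
by rewrite /mnb big1 ?oppr0 // => i _; rewrite tnth_mktuple.
Qed.

End BoxPower.

(** * Boundary, faces and permutations on the box power *)

Section BoxOperators.
Variables (R : realType) (m : nat).
Local Notation mword := (mword m).
Local Notation mbas := (mbas R).
Local Notation bas := (bas R).
Implicit Types U V : mword.

Definition set_factor U (i : 'I_m) (w : word) : mword :=
  [tuple if j == i then w else tnth U j | j < m].

Lemma replace_factor_bas U i w : replace_factor U i (bas w) = mbas (set_factor U i w).
Proof. exact: lin_extU. Qed.

Lemma mbdry_bas U : mbdry (mbas U) = \sum_(i < m)
  (-1) ^+ (\sum_(j < m | (j < i)%N) nb (tnth U j))%N *:
    replace_factor U i (bdry_word R (tnth U i)).
Proof. exact: lin_extU. Qed.

Lemma replace_factorP U i (c : R) x y :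
  replace_factor U i (c *: x + y) =
  c *: replace_factor U i x + replace_factor U i y.
Proof. exact: linearP. Qed.

Lemma replace_factorB U i (x y : Omega R) :
  replace_factor U i (x - y) = replace_factor U i x - replace_factor U i y.
Proof. exact: linearB. Qed.

Lemma mbdryP (c : R) (x y : OmegaM R m) :
  mbdry (c *: x + y) = c *: mbdry x + mbdry y.
Proof. exact: linearP. Qed.

Lemma mbdryZ (c : R) (x : OmegaM R m) : mbdry (c *: x) = c *: mbdry x.
Proof. exact: linearZ. Qed.

Lemma mbdry_sum (I : Type) (r : seq I) (P : pred I) (F : I -> OmegaM R m) :
  mbdry (\sum_(i <- r | P i) F i) = \sum_(i <- r | P i) mbdry (F i).
Proof. exact: linear_sum. Qed.

Lemma mfaceP i (c : R) (x y : OmegaM R m) :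
  mface i (c *: x + y) = c *: mface i x + mface i y.
Proof. exact: linearP. Qed.

(** Lowering the number of b's in factor [i] of [U] by one changes the shuffle
    sign by the number of b's that this letter was moved past. *)
Lemma mdia_replace_factorl U V i y :
  supported (fun w => (nb w).+1 = nb (tnth U i)) y ->
  mdia (replace_factor U i y) (mbas V) =
  ((-1) ^+ (\sum_(j < m | (j < i)%N) nb (tnth V j))%N * shuffle_sign R U V) *:
    replace_factor (mcat U V) i (dia y (bas (tnth V i))).
Proof.
move=> supp_y; apply: (linear_ext (F := fun y => mdia (replace_factor U i y) _)
  (G := fun y => _ *: replace_factor (mcat U V) i (dia y _))) => [c a b|c a b|w wy].
- by rewrite replace_factorP mdiaPl.
- by rewrite diaPl replace_factorP scalerDr !scalerA [_ * c]mulrC.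
rewrite -/(bas w) dia_bas 2!replace_factor_bas mdia_bas.
apply: scale_mbas_congr.
  rewrite !shuffle_signE -shuffle_exp_deltal.
  set d := fun j : 'I_m => (j == i) : nat.
  have -> : shuffle_exp (fun j => nb (tnth U j)) (fun j => nb (tnth V j)) =
      (shuffle_exp (fun j => nb (tnth (set_factor U i w) j)) (fun j => nb (tnth V j))
       + shuffle_exp d (fun j => nb (tnth V j)))%N.
    rewrite -shuffle_expDl; apply: eq_shuffle_exp => j //.
    rewrite tnth_mktuple /d; case: eqP => [->|_]; last by rewrite addn0.
    by rewrite addn1; case: (supp_y w wy).
  by rewrite exprD mulrC -mulrA -expr2 sqrr_sign mulr1.
apply: eq_from_tnth => j; rewrite !tnth_mktuple.
by case: eqP => [->|].
Qed.

Lemma mdia_replace_factorr U V i y :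
  supported (fun w => (nb w).+1 = nb (tnth V i)) y ->
  mdia (mbas U) (replace_factor V i y) =
  ((-1) ^+ (\sum_(j < m | (i < j)%N) nb (tnth U j))%N * shuffle_sign R U V) *:
    replace_factor (mcat U V) i (dia (bas (tnth U i)) y).
Proof.
move=> supp_y; apply: (linear_ext (F := fun y => mdia _ (replace_factor V i y))
  (G := fun y => _ *: replace_factor (mcat U V) i (dia _ y))) => [c a b|c a b|w wy].
- by rewrite replace_factorP mdiaPr.
- by rewrite diaPr replace_factorP scalerDr !scalerA [_ * c]mulrC.
rewrite -/(bas w) dia_bas 2!replace_factor_bas mdia_bas.
apply: scale_mbas_congr.
  rewrite !shuffle_signE -shuffle_exp_deltar.
  set d := fun j : 'I_m => (j == i) : nat.
  have -> : shuffle_exp (fun j => nb (tnth U j)) (fun j => nb (tnth V j)) =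
      (shuffle_exp (fun j => nb (tnth U j)) (fun j => nb (tnth (set_factor V i w) j))
       + shuffle_exp (fun j => nb (tnth U j)) d)%N.
    rewrite -shuffle_expDr; apply: eq_shuffle_exp => j //.
    rewrite tnth_mktuple /d; case: eqP => [->|_]; last by rewrite addn0.
    by rewrite addn1; case: (supp_y w wy).
  by rewrite exprD mulrC -mulrA -expr2 sqrr_sign mulr1.
apply: eq_from_tnth => j; rewrite !tnth_mktuple.
by case: eqP => [->|].
Qed.

Lemma replace_factorDZ U i (c : R) x y :
  replace_factor U i (x + c *: y) =
  replace_factor U i x + c *: replace_factor U i y.
Proof. by rewrite addrC replace_factorP addrC. Qed.

Fact scale_leibniz (V : lmodType R) (s p n p1 q1 e p2 q2 : R) (A B : V) :
  s * p = p1 * q1 -> s * p * n = e * (p2 * q2) ->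
  s *: (p *: (A + n *: B)) = p1 *: (q1 *: A) + e *: (p2 *: (q2 *: B)).
Proof. by move=> h1 h2; rewrite !scalerDr !scalerA h2 h1 mulrA. Qed.

Lemma mnb_split U (i : 'I_m) : mnb U =
  ((\sum_(j < m | (j < i)%N) nb (tnth U j)) + nb (tnth U i)
   + \sum_(j < m | (i < j)%N) nb (tnth U j))%N.
Proof.
rewrite /mnb (bigID (fun j : 'I_m => (j < i)%N)) /= -addnA; congr (_ + _)%N.
rewrite (bigD1 i) ?ltnn //=; congr (_ + _)%N; apply: eq_bigl => j.
by rewrite -leqNgt [in RHS]ltn_neqAle eq_sym andbC.
Qed.

(** Passing the boundary into factor [i] of a product [U V] crosses the b's of
    [U] before [i] and those of [V] before [i]; the shuffle sign accounts for the
    difference with the sign rules on each side. *)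
Lemma mbdry_mdia (n : nat) x y : supported (fun U => mnb U = n) x ->
  mbdry (mdia x y) = mdia (mbdry x) y + (-1) ^+ n *: mdia x (@mbdry R m y).
Proof.
move=> supp_x; apply: (bilinear_ext (F := fun x y => mbdry (mdia x y))
  (G := fun x y => mdia (mbdry x) y + (-1) ^+ n *: mdia x (mbdry y)))
  => [v|u|v|u|U V xU _].
- by move=> c a b; rewrite mdiaPl mbdryP.
- by move=> c a b; rewrite mdiaPr mbdryP.
- move=> c a b; rewrite mbdryP 2!mdiaPl 2!scalerDr 2!scalerA addrACA.
  by rewrite [c * _]mulrC.
- move=> c a b; rewrite mbdryP 2!mdiaPr 2!scalerDr 2!scalerA addrACA.
  by rewrite [c * _]mulrC.
rewrite -/(mbas U) -/(mbas V) mdia_bas -[_ *: mbas _]addr0 mbdryP.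
rewrite [mbdry 0](linear0 (@mbdry R m)) addr0 3!mbdry_bas.
rewrite mdia_suml mdia_sumr !scaler_sumr -big_split; apply: eq_bigr => i _ /=.
rewrite mdiaZl mdiaZr mdia_replace_factorl; last first.
  by apply: supported_weaken (@bdry_word_supp R _) => w [].
rewrite mdia_replace_factorr; last first.
  by apply: supported_weaken (@bdry_word_supp R _) => w [].
rewrite tnth_mcat bdry_word_cat replace_factorDZ.
rewrite (eq_bigr (fun j => nb (tnth U j) + nb (tnth V j))%N); last first.
  by move=> j _; rewrite tnth_mcat nb_cat.
rewrite big_split /= -(supp_x U xU) (mnb_split U i).
set a := (\sum_(j < m | (j < i)%N) nb (tnth U j))%N.
set b := (\sum_(j < m | (j < i)%N) nb (tnth V j))%N.
set c := (\sum_(j < m | (i < j)%N) nb (tnth U j))%N.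
have cc : (-1) ^+ c * (-1) ^+ c = 1 :> R by rewrite -expr2 sqrr_sign.
apply: scale_leibniz; first by rewrite exprD mulrC mulrA.
move: (shuffle_sign R U V) cc; rewrite !exprD.
move: (_ ^+ a) (_ ^+ b) (_ ^+ c) (_ ^+ nb _) => A B C N s cc.
by rewrite -[LHS]mulr1 -cc; ring.
Qed.

Lemma mface_mdia (i : nat) x y : supported (fun U => forall j, size (tnth U j) = i) x ->
  mface i.+1 (mdia x y) = mdia (mdia x (mdiag R m [:: La])) y.
Proof.
move=> supp_x; apply: (bilinear_ext (F := fun x y => mface i.+1 (mdia x y))
  (G := fun x y => mdia (mdia x (mdiag R m [:: La])) y)) => [v|u|v|u|U V xU _].
- by move=> c a b; rewrite mdiaPl mfaceP.
- by move=> c a b; rewrite mdiaPr mfaceP.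
- by move=> c a b; rewrite 2!mdiaPl.
- by move=> c a b; rewrite mdiaPr.
rewrite -/(mbas U) -/(mbas V) (mdia_bas_diag R (w := [:: La]) U erefl) 2!mdia_bas.
rewrite -[_ *: mbas _]addr0 mfaceP [mface _ 0](linear0 (@mface R m i.+1)) addr0.
rewrite shuffle_sign_catl [X in _ = (_ * X) *: _]shuffle_sign_nb0l => [|j].
  rewrite mulr1 [mface _ _]lin_extU; apply: scale_mbas_congr => //.
  apply: eq_from_tnth => j.
  rewrite !tnth_mktuple /face_word /= take_size_cat ?drop_size_cat ?(supp_x U xU) //.
  by rewrite -catA.
by rewrite tnth_mktuple.
Qed.

Lemma mface_diag_nil : mface 1 (mdiag R m [::]) = mdiag R m [:: La].
Proof.
rewrite [LHS]lin_extU; congr mbas; apply: eq_from_tnth => j.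
by rewrite !tnth_mktuple.
Qed.

End BoxOperators.

Section BoxPermutations.
Variables (R : realType) (m : nat) (s : {perm 'I_m}).
Local Notation mword := (mword m).
Local Notation mbas := (mbas R).

Definition perm_exp (f : 'I_m -> nat) : nat :=
  (\sum_(i < m) \sum_(j < m | (i < j) && (s j < s i)) f (s i) * f (s j))%N.

Definition permw (W : mword) : mword := [tuple tnth W (s i) | i < m].

Lemma mperm_bas W : mperm s (mbas W) =
  (-1) ^+ perm_exp (fun i => nb (tnth W i)) *: mbas (permw W).
Proof. exact: lin_extU. Qed.

Lemma mpermP (c : R) (x y : OmegaM R m) :
  mperm s (c *: x + y) = c *: mperm s x + mperm s y.
Proof. exact: linearP. Qed.

Lemma mpermZ (c : R) (x : OmegaM R m) : mperm s (c *: x) = c *: mperm s x.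
Proof. exact: linearZ. Qed.

Lemma mperm_sum (I : Type) (r : seq I) (P : pred I) (F : I -> OmegaM R m) :
  mperm s (\sum_(i <- r | P i) F i) = \sum_(i <- r | P i) mperm s (F i).
Proof. exact: linear_sum. Qed.

Lemma double_sum_cond (P : 'I_m -> 'I_m -> bool) (F : 'I_m -> 'I_m -> nat) :
  (\sum_(i < m) \sum_(j < m | P i j) F i j =
   \sum_(i < m) \sum_(j < m) P i j * F i j)%N.
Proof.
apply: eq_bigr => i _; rewrite big_mkcond; apply: eq_bigr => j _.
by case: (P i j); rewrite ?mul1n ?mul0n.
Qed.

(** The cross terms [f p * g q] are counted by the inversions of [s], by the
    shuffle before and by the shuffle after permuting; each of them occurs an
    even number of times in total. *)
Lemma perm_exp_shuffle f g : exists t,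
  (perm_exp (fun i => f i + g i) + shuffle_exp f g =
   perm_exp f + perm_exp g
   + shuffle_exp (fun i => f (s i)) (fun i => g (s i)) + t.*2)%N.
Proof.
exists (\sum_(i < m) \sum_(j < m | (i < j) && (s j < s i)) f (s i) * g (s j))%N.
have -> : shuffle_exp f g =
    (\sum_(i < m) \sum_(j < m | s j < s i) f (s i) * g (s j))%N.
  rewrite /shuffle_exp (reindex_inj (@perm_inj _ s)); apply: eq_bigr => i _.
  by rewrite (reindex_inj (@perm_inj _ s)).
have swap : (\sum_(i < m) \sum_(j < m | (i < j) && (s j < s i)) g (s i) * f (s j)
    = \sum_(i < m) \sum_(j < m | (j < i) && (s i < s j)) f (s i) * g (s j))%N.
  rewrite [LHS]double_sum_cond [RHS]double_sum_cond exchange_big; apply: eq_bigr => i _.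
  by apply: eq_bigr => j _; rewrite [(g _ * _)%N]mulnC.
have -> : perm_exp (fun i => f i + g i)%N = (perm_exp f + perm_exp g
    + \sum_(i < m) \sum_(j < m | (i < j) && (s j < s i)) f (s i) * g (s j)
    + \sum_(i < m) \sum_(j < m | (j < i) && (s i < s j)) f (s i) * g (s j))%N.
  rewrite -swap -!big_split; apply: eq_bigr => i _ /=.
  rewrite -!big_split; apply: eq_bigr => j _ /=.
  by rewrite mulnDl !mulnDr; lia.
rewrite -!addnA; do 2!congr (_ + _)%N.
rewrite /shuffle_exp (double_sum_cond (fun i j => (i < j) && (s j < s i)))%N.
rewrite (double_sum_cond (fun i j => (j < i) && (s i < s j)))%N.
rewrite (double_sum_cond (fun i j => s j < s i))%N.
rewrite (double_sum_cond (fun i j : 'I_m => j < i))%N.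
rewrite -addnn -!big_split; apply: eq_bigr => i _ /=.
rewrite -!big_split; apply: eq_bigr => j _ /=; rewrite -!mulnDl; congr (_ * _)%N.
case: (ltngtP i j) => [ij|ji|/ord_inj ->]; last by rewrite ltnn.
  by case: (s j < s i)%N.
case: (ltngtP (s j) (s i)) => // /ord_inj /perm_inj ji'.
by rewrite ji' ltnn in ji.
Qed.

Lemma permw_cat U V : permw (mcat U V) = mcat (permw U) (permw V).
Proof. by apply: eq_from_tnth => i; rewrite !tnth_mktuple. Qed.

Lemma mperm_mdia x y : mperm s (mdia x y) = mdia (mperm s x) (@mperm R m s y).
Proof.
apply: (bilinear_ext (F := fun x y => mperm s (mdia x y))
  (G := fun x y => mdia (mperm s x) (mperm s y))) => [v|u|v|u|U V _ _].
- by move=> c a b; rewrite mdiaPl mpermP.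
- by move=> c a b; rewrite mdiaPr mpermP.
- by move=> c a b; rewrite mpermP mdiaPl.
- by move=> c a b; rewrite mpermP mdiaPr.
rewrite -/(mbas U) -/(mbas V) mdia_bas -[_ *: mbas _]addr0 mpermP.
rewrite [mperm _ 0](linear0 (@mperm R m s)) addr0 3!mperm_bas.
rewrite mdiaZl mdiaZr mdia_bas !scalerA permw_cat; apply: scale_mbas_congr => //.
set u := fun i => nb (tnth U i); set v := fun i => nb (tnth V i).
have -> : perm_exp (fun i => nb (tnth (mcat U V) i)) =
          perm_exp (fun i => u i + v i)%N.
  apply: eq_bigr => i _; apply: eq_bigr => j _.
  by rewrite !tnth_mcat !nb_cat.
rewrite !shuffle_signE -!exprD addnC.
have -> : shuffle_exp (fun i => nb (tnth (permw U) i))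
    (fun i => nb (tnth (permw V) i)) =
    shuffle_exp (fun i => u (s i)) (fun i => v (s i)).
  by apply: eq_shuffle_exp => i; rewrite tnth_mktuple.
have [t ->] := perm_exp_shuffle u v.
by rewrite exprD -muln2 exprM sqrr_sign mulr1 exprD.
Qed.

Lemma mperm_nil : mperm s (mdiag R m [::]) = mdiag R m [::].
Proof.
rewrite mperm_bas /perm_exp big1 => [|i _].
  rewrite expr0 scale1r; congr mbas; apply: eq_from_tnth => i.
  by rewrite !tnth_mktuple.
by rewrite big1 // => j _; rewrite !tnth_mktuple.
Qed.

End BoxPermutations.

(** * Words are generated by the b^n under faces and circ *)

Section WordGeneration.
Variable R : realType.
Local Notation bas := (bas R).

(** The induction steps are a face and a composition, see [face_bas] and
    [circ_bas]. *)
Lemma word_gen_ind (P : word -> Prop) :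
  (forall n, P (nseq n Lb)) ->
  (forall u v, P (u ++ v) -> P (u ++ La :: v)) ->
  (forall u v, P u -> P v -> P (u ++ Lc :: v)) ->
  forall w, P w.
Proof.
move=> Pb Pa Pc w; have [n] := ubnP (size w).
elim: n w => // n IHn w; rewrite ltnS => wn.
have [/(nthP Lb)[i iw wi]|aw] := boolP (La \in w).
  rewrite -(cat_take_drop i w) (drop_nth Lb iw) wi; apply: Pa; apply: IHn.
  have {}iw : (i < size w)%N := iw.
  by rewrite size_cat size_take iw /= size_drop; lia.
have [/(nthP Lb)[i iw wi]|cw] := boolP (Lc \in w).
  rewrite -(cat_take_drop i w) (drop_nth Lb iw) wi.
  have {}iw : (i < size w)%N := iw.
  by apply: Pc; apply: IHn; rewrite ?size_take ?iw /= ?size_drop; lia.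
suff -> : w = nseq (size w) Lb by [].
apply/all_pred1P/allP => -[] // lw; first by rewrite lw in aw.
by rewrite lw in cw.
Qed.

Lemma face_bas u v : face (size u).+1 (bas (u ++ v)) = bas (u ++ La :: v).
Proof.
by rewrite [LHS]lin_extU /face_word /= take_size_cat // drop_size_cat.
Qed.

Lemma circ_bas u v : circ (bas u) (bas v) = bas (u ++ Lc :: v).
Proof. by rewrite /circ 2!dia_bas -catA. Qed.

Lemma homog_bas w : homog (size w).+1 (- (nb w)%:Z) (bas w).
Proof. exact: supportedU. Qed.

Lemma nb_nseq n : nb (nseq n Lb) = n.
Proof. by rewrite /nb count_nseq mul1n. Qed.

Lemma bdry_word_nb0 w : nb w = 0%N -> bdry_word R w = 0.
Proof.
move=> w0; apply/malgP => v; rewrite mcoeff0; apply: mcoeff_outdom.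
by apply/negP => /(bdry_word_supp (w := w)) []; rewrite w0.
Qed.

Definition nseq_with (l : letter) (n i : nat) : word :=
  nseq i Lb ++ l :: nseq (n - i.+1) Lb.

Lemma bdry_word_nseq n : bdry_word R (nseq n Lb) =
  \sum_(i < n) (-1) ^+ i *: (bas (nseq_with Lc n i) - bas (nseq_with La n i)).
Proof.
elim: n => [|n IHn]; first by rewrite big_ord0.
rewrite -[nseq n.+1 Lb]/(Lb :: nseq n Lb) bdry_word_cons {}IHn big_ord_recl.
rewrite expr0 scale1r dia_sumr scaler_sumr; congr (_ + _).
  by rewrite /bdry_letter eqxx diaBl 2!dia_bas /nseq_with subn1.
apply: eq_bigr => i _; rewrite diaZr scalerA -exprS; congr (_ *: _).
by rewrite diaBr 2!dia_bas.
Qed.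

End WordGeneration.

(** * The algebra map sending b to x *)

Section AlgebraMap.
Variables (R : realType) (m : nat) (x : OmegaM R m).
Local Notation bas := (bas R).

Definition letter_image (l : letter) : OmegaM R m :=
  if l is Lb then x else mdiag R m [:: l].

Definition word_image (w : word) : OmegaM R m :=
  foldr (fun l y => mdia (letter_image l) y) (mdiag R m [::]) w.

Definition alg_map (y : Omega R) : OmegaM R m := lin_ext word_image y.

Lemma alg_map_bas w : alg_map (bas w) = word_image w.
Proof. exact: lin_extU. Qed.

Lemma alg_mapP (c : R) y z : alg_map (c *: y + z) = c *: alg_map y + alg_map z.
Proof. exact: linearP. Qed.

Lemma alg_mapDZ y z (c : R) : alg_map (y + c *: z) = alg_map y + c *: alg_map z.
Proof. by rewrite addrC alg_mapP addrC. Qed.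

Lemma alg_mapZ (c : R) y : alg_map (c *: y) = c *: alg_map y.
Proof. exact: linearZ. Qed.

Lemma alg_map_sum (I : Type) (r : seq I) (P : pred I) F :
  alg_map (\sum_(i <- r | P i) F i) = \sum_(i <- r | P i) alg_map (F i).
Proof. exact: linear_sum. Qed.

Lemma alg_mapB y z : alg_map (y - z) = alg_map y - alg_map z.
Proof. exact: linearB. Qed.

Lemma word_image_cons l w :
  word_image (l :: w) = mdia (letter_image l) (word_image w).
Proof. by []. Qed.

Lemma word_image_cat u v :
  word_image (u ++ v) = mdia (word_image u) (word_image v).
Proof.
elim: u => [|l u IHu]; first by rewrite mdia1l.
by rewrite cat_cons 2!word_image_cons {}IHu mdiaA.
Qed.

Lemma word_image1 l : word_image [:: l] = letter_image l.
Proof. exact: mdia1r. Qed.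

Lemma word_image_nseq n : word_image (nseq n Lb) = mdia_exp x n.
Proof.
elim: n => [|n IHn]; first by [].
by rewrite -[nseq n.+1 Lb]/(Lb :: nseq n Lb) word_image_cons {}IHn.
Qed.

Lemma alg_map_dia y z : alg_map (dia y z) = mdia (alg_map y) (alg_map z).
Proof.
apply: (bilinear_ext (F := fun y z => alg_map (dia y z))
  (G := fun y z => mdia (alg_map y) (alg_map z))) => [v|u|v|u|u v _ _].
- by move=> c a b; rewrite diaPl alg_mapP.
- by move=> c a b; rewrite diaPr alg_mapP.
- by move=> c a b; rewrite alg_mapP mdiaPl.
- by move=> c a b; rewrite alg_mapP mdiaPr.
by rewrite -/(bas u) -/(bas v) dia_bas 3!alg_map_bas word_image_cat.
Qed.

Lemma alg_map_circ y z : alg_map (circ y z) = mcirc (alg_map y) (alg_map z).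
Proof. by rewrite /circ 2!alg_map_dia alg_map_bas word_image1 mcircE. Qed.

Hypothesis x_homog : mhomog 2 (-1) x.

Lemma mhomog_word_image w :
  mhomog (size w).+1 (- (nb w)%:Z) (word_image w).
Proof.
elim: w => [|l w IHw]; first by rewrite oppr0; exact: mhomog_diag.
rewrite word_image_cons -[l :: w]cat1s nb_cat PoszD opprD.
apply: (@mhomog_mdia _ _ 1 _ (size w)) => //; case: l => //.
- by rewrite oppr0; exact: mhomog_diag.
- by rewrite oppr0; exact: mhomog_diag.
Qed.

Lemma mhomog_alg_map k l y : homog k l y -> mhomog k l (alg_map y).
Proof.
move=> hy; apply: supported_lin_ext hy _ => w [<- <-].
exact: mhomog_word_image.
Qed.

Lemma alg_map_face k l i y : homog k l y -> (1 <= i <= k)%N ->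
  alg_map (face i y) = mface i (alg_map y).
Proof.
move=> hy; case: i => // i /= ik.
apply: (linear_ext (F := fun y => alg_map (face i.+1 y))
  (G := fun y => mface i.+1 (alg_map y))) => [c a b|c a b|w /hy[sw _]].
- by rewrite [face _ _](linearP (@face R i.+1)) alg_mapP.
- by rewrite alg_mapP mfaceP.
have iw : size (take i w) = i by rewrite size_takel // -ltnS sw.
rewrite -/(bas w) -(cat_take_drop i w).
have := face_bas R (take i w) (drop i w); rewrite iw => ->.
rewrite !alg_map_bas !word_image_cat word_image_cons mface_mdia ?mdiaA // => U.
by move=> /mhomog_word_image[+ _] j => /(_ j) []; rewrite iw.
Qed.

Hypothesis x_bdry : mbdry x = mdiag R m [:: Lc] - mdiag R m [:: La].

Lemma mbdry_diag w : nb w = 0%N -> mbdry (mdiag R m w) = 0.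
Proof.
move=> w0; rewrite mbdry_bas big1 // => i _.
rewrite tnth_mktuple bdry_word_nb0 // [replace_factor _ _ _]linear0.
exact: scaler0.
Qed.

Lemma mbdry_letter_image l :
  mbdry (letter_image l) = alg_map (bdry_letter R l).
Proof.
case: l; rewrite /bdry_letter /=.
- by rewrite mbdry_diag // [alg_map 0]linear0.
- by rewrite x_bdry alg_mapB 2!alg_map_bas 2!word_image1.
- by rewrite mbdry_diag // [alg_map 0]linear0.
Qed.

Lemma alg_map_bdry y : alg_map (bdry y) = mbdry (alg_map y).
Proof.
apply: (linear_ext (F := fun y => alg_map (bdry y))
  (G := fun y => mbdry (alg_map y))) => [c a b|c a b|w _].
- by rewrite [bdry _](linearP (@bdry R)) alg_mapP.
- by rewrite alg_mapP mbdryP.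
rewrite -/(bas w) alg_map_bas bdry_bas.
elim: w => [|l w IHw].
  by rewrite mbdry_diag // [bdry_word _ _]/= [alg_map 0]linear0.
rewrite bdry_word_cons word_image_cons (@mbdry_mdia _ _ (nb [:: l])); last first.
  by move=> U; rewrite -word_image1 => /mhomog_word_image[_] /oppr_inj [].
rewrite alg_mapDZ 2!alg_map_dia 2!alg_map_bas {}IHw word_image1.
by rewrite mbdry_letter_image.
Qed.

End AlgebraMap.

(** * Rigid Maurer-Cartan elements are geometric series *)

Section RigidMC.
Variables (R : realType) (m : nat).
Local Notation bas := (bas R).

Lemma geom_seriesS (x : OmegaM R m) n : geom_series x n.+1 = mdia_exp x n.
Proof. by []. Qed.

Lemma mdia_expS (x : OmegaM R m) n : mdia_exp x n.+1 = mdia x (mdia_exp x n).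
Proof. by []. Qed.

Lemma geom_series_word (x : OmegaM R m) n :
  geom_series x n.+1 = alg_map x (bas (nseq n Lb)).
Proof. by rewrite alg_map_bas word_image_nseq. Qed.

Lemma geom_series2 (x : OmegaM R m) : geom_series x 2 = x.
Proof. by rewrite geom_seriesS mdia_expS mdia1r. Qed.

Section FromR.
Variable x : OmegaM R m.
Hypothesis x_R : @Rset R m x.

Let x_homog : mhomog 2 (-1) x := proj1 x_R.
Let x_bdry : mbdry x = mdiag R m [:: Lc] - mdiag R m [:: La] := proj2 x_R.

Lemma alg_map_is_Delta : is_Delta (geom_series x) (alg_map x).
Proof.
split; last split.
- exact: alg_mapP.
- exact: mhomog_alg_map.
- exact: alg_map_circ.
- exact: alg_map_bdry.
- by move=> k l i y; exact: alg_map_face.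
- by case=> // n _; rewrite geom_series_word.
Qed.

Lemma mface_geom_series n (i : 'I_n) :
  mface i.+1 (geom_series x n) = alg_map x (bas (nseq_with La n i)).
Proof.
case: n i => [[]//|n] i; rewrite geom_series_word.
have i_n : (1 <= i.+1 <= (size (nseq n Lb)).+1)%N by rewrite size_nseq ltn_ord.
rewrite -(alg_map_face x_homog (@homog_bas R (nseq n Lb)) i_n); congr (alg_map x _).
have -> : nseq n Lb = nseq i Lb ++ nseq (n - i) Lb.
  by rewrite -nseqD subnKC // leq_ord.
by have := face_bas R (nseq i Lb) (nseq (n - i) Lb); rewrite size_nseq.
Qed.

Lemma mcirc_geom_series n (i : 'I_n) :
  mcirc (geom_series x i.+1) (geom_series x (n - i)%N) =
  alg_map x (bas (nseq_with Lc n i)).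
Proof.
rewrite -[(n - i)%N]prednK ?subn_gt0 // -subnS 2!geom_series_word -alg_map_circ.
by rewrite circ_bas.
Qed.

(** The Maurer-Cartan equation is the image under [alg_map x] of the formula for
    the boundary of b^n. *)
Lemma MC_geom_series : MC (geom_series x).
Proof.
split=> [[|n]|k|]; last by [].
- exact: supported0.
- rewrite geom_series_word alg_map_bas.
  have := @mhomog_word_image _ _ _ x_homog (nseq n Lb).
  rewrite nb_nseq size_nseq; congr mhomog.
  by rewrite -addn1 PoszD opprD addrCA subrr addr0.
have [om omE] : exists om, om = geom_series x by exists (geom_series x).
have om0 : om 0%N = 0 by rewrite omE.
rewrite -omE; case: k => [|n]; rewrite /dtot /star.
  rewrite big_geq // scaler0 addr0 big_ord1 om0 mcirc0l scaler0 addr0.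
  exact: linear0.
rewrite big_add1 big_mkord big_ord_recl big_ord_recr /= subnn om0 mcirc0l mcirc0r.
rewrite !scaler0 add0r addr0 {1}omE geom_series_word.
rewrite -(alg_map_bdry x_homog x_bdry) bdry_bas.
rewrite bdry_word_nseq alg_map_sum scaler_sumr -!big_split big1 // => i _.
rewrite /bump /= add1n subSS omE mface_geom_series mcirc_geom_series.
rewrite alg_mapZ alg_mapB.
rewrite expr1z mulr1 -exprnP exprS scalerA.
move: (alg_map _ _) (alg_map _ _) => C A.
by rewrite !mulN1r opprK scaleNr scalerBr subrK subrr.
Qed.

End FromR.

(** Every word is reached from words b^n by faces and compositions. *)
Lemma is_Delta_unique (om : bar R m) D D' :
  is_Delta om D -> is_Delta om D' -> D = D'.
Proof.
case=> lD _ Dc _ [Df DL] [lD' _ Dc' _ [Df' DL']]; apply: funext => y.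
apply: (linear_ext lD lD') => w _; rewrite -/(bas w).
elim/word_gen_ind: w => [n|u v IH|u v IHu IHv].
- by rewrite [LHS](DL n.+1) // [RHS](DL' n.+1).
- have uv : (1 <= (size u).+1 <= (size (u ++ v)).+1)%N.
    by rewrite /= ltnS size_cat leq_addr.
  rewrite -face_bas (Df _ _ _ _ (@homog_bas R (u ++ v)) uv).
  by rewrite (Df' _ _ _ _ (@homog_bas R (u ++ v)) uv) IH.
- by rewrite -circ_bas Dc Dc' IHu IHv.
Qed.

Lemma Delta_eq (om : bar R m) D : is_Delta om D -> Delta om = D.
Proof.
move=> omD; rewrite /Delta; case: xgetP => [D' _ omD'|noD].
  exact: is_Delta_unique omD' omD.
by case: (noD D).
Qed.

Lemma rigid_geom_series x : Rset x -> rigid (@geom_series R m x).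
Proof.
move=> /alg_map_is_Delta /Delta_eq xD; rewrite /rigid xD; split.
  by rewrite alg_map_bas.
exact: alg_map_dia.
Qed.

Lemma mdiag_neq0 w : mdiag R m w != 0.
Proof.
apply/eqP => /(congr1 (mcoeff [tuple w | _ < m])) /eqP.
by rewrite mcoeffUU mcoeff0 oner_eq0.
Qed.

(** When no map satisfies the defining conditions, [Delta om] is zero by
    convention; a rigid [om] therefore does come with such a map. *)
Lemma rigid_is_Delta (om : bar R m) : rigid om -> is_Delta om (Delta om).
Proof.
case=> De _; move: De; rewrite /Delta; case: xgetP => [D -> //|_ e0].
by case/eqP: (mdiag_neq0 [::]); rewrite -e0.
Qed.

(** Multiplicativity gives the powers; the values of the map on a and c are
    known because a is a face and c a composition of the empty word. *)
Lemma rigid_geom (om : bar R m) : (0 < m)%N -> MC om -> rigid om ->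
  Rset (om 2%N) /\ om = geom_series (om 2%N).
Proof.
move=> m0 [om_deg _ om1] rig; have [lD hD Dc Db [Df DL]] := rigid_is_Delta rig.
case: rig; move: (Delta om) lD hD Dc Db Df DL => D lD hD Dc Db Df DL De Dd.
have D2 : om 2%N = D (bas [:: Lb]) by rewrite -[om _]DL.
have Da : D (bas [:: La]) = mdiag R m [:: La].
  have := face_bas R [::] [::]; rewrite /= => <-.
  by rewrite (Df 1%N 0) ?De ?mface_diag_nil //; exact: @homog_bas R [::].
have DcE : D (bas [:: Lc]) = mdiag R m [:: Lc].
  have := circ_bas R [::] [::]; rewrite /= => <-.
  by rewrite Dc De mcircE mdia1l mdia1r.
split.
  split; first by rewrite D2; apply: hD; exact: @homog_bas R [:: Lb].
  rewrite D2 -Db bdry_bas bdry_word_cons /bdry_letter eqxx dia0r scaler0 addr0.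
  rewrite diaBl 2!dia_bas -scaleN1r addrC.
  by rewrite lD scaleN1r addrC Da DcE.
apply: funext => -[|n].
  apply/malgP => W; rewrite mcoeff0; apply: mcoeff_outdom; apply/negP.
  by move=> /om_deg[/(_ (Ordinal m0))].
rewrite -DL // geom_seriesS /Lgen [n.+1.-1]/=.
elim: n => [|n IHn]; first exact: De.
by rewrite mdia_expS -IHn D2 -Dd dia_bas.
Qed.

Theorem rigid_MC_bij : (0 < m)%N ->
  set_bij (@Rset R m) [set om | MC om /\ rigid om] (@geom_series R m).
Proof.
move=> m0; split=> [x xR|x y _ _ xy|om [MCom rig]].
- by split; [exact: MC_geom_series|exact: rigid_geom_series].
- by rewrite -(geom_series2 x) xy geom_series2.
- by have [omR ->] := rigid_geom m0 MCom rig; exists (om 2%N).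
Qed.

End RigidMC.

(** * Elements of bidegree (2,-1) as chains on the edges of the cube *)

Section CubeEdges.
Variables (R : realType) (m : nat).
Local Notation mbas := (mbas R).
Local Notation bas := (bas R).
Implicit Types (i j : 'I_m) (S T : {set 'I_m}).

Definition vertex S : mword m := [tuple [:: if j \in S then Lc else La] | j < m].

(** For [i \notin S] this is the edge of the cube in direction [i] from the vertex
    [S] to the vertex [i |: S]. *)
Definition edge i S : mword m := set_factor (vertex S) i [:: Lb].

Lemma tnth_vertex S j : tnth (vertex S) j = [:: if j \in S then Lc else La].
Proof. exact: tnth_mktuple. Qed.

Lemma tnth_edge i S j : tnth (edge i S) j =
  if j == i then [:: Lb] else [:: if j \in S then Lc else La].
Proof. by rewrite !tnth_mktuple. Qed.

Lemma nb_edge i S j : nb (tnth (edge i S) j) = (j == i).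
Proof. by rewrite tnth_edge; case: (j == i) => //; case: (j \in S). Qed.

Lemma vertex_inj : injective vertex.
Proof.
move=> S T ST; apply/setP => j; have := congr1 (fun W : mword m => tnth W j) ST.
by rewrite !tnth_vertex; do 2!case: (j \in _).
Qed.

Lemma edge_inj i S j T : i \notin S -> j \notin T ->
  edge i S = edge j T -> i = j /\ S = T.
Proof.
move=> iS jT E; have ij : i = j.
  have := congr1 (fun W : mword m => nb (tnth W i)) E; rewrite !nb_edge eqxx.
  by case: eqP.
subst j; split=> //; apply/setP => k; have := congr1 (fun W : mword m => tnth W k) E.
rewrite !tnth_edge; case: eqP => [->|_]; first by rewrite (negPf iS) (negPf jT).
by do 2!case: (k \in _).
Qed.

Lemma mhomog_edge i S : mhomog 2 (-1) (mbas (edge i S)).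
Proof.
apply: supportedU; split=> [j|]; first by rewrite tnth_edge; case: eqP.
congr (- _%:Z); rewrite /mnb (bigD1 i) //= big1 ?addn0 => [|j ji].
  by rewrite nb_edge eqxx.
by rewrite nb_edge (negPf ji).
Qed.

Lemma word_edge (W : mword m) : (forall i, size (tnth W i) = 1%N) -> mnb W = 1%N ->
  exists i S, i \notin S /\ W = edge i S.
Proof.
move=> sW nW.
have [i Wi] : exists i, tnth W i = [:: Lb].
  have [/existsP[i /eqP]|/existsPn noi] :=
    boolP [exists i, tnth W i == [:: Lb] :> seq letter].
    by exists i.
  suff : mnb W = 0%N by rewrite nW.
  rewrite /mnb big1 // => j _; have := sW j; have := noi j.
  by case: (tnth W j) => [|[] []].
exists i, [set j | tnth W j == [:: Lc] :> seq letter]%SET; split.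
  by rewrite inE Wi.
apply: eq_from_tnth => j; rewrite tnth_edge inE; case: eqP => [-> //|/eqP ji].
have : nb (tnth W j) = 0%N.
  move: nW; rewrite /mnb (bigD1 i) //= Wi (bigD1 j) //= /nb /=.
  by case: (count_mem _ (tnth W j)).
by have := sW j; case: (tnth W j) => [|[] []].
Qed.

Definition edge_sum (a : 'I_m -> {set 'I_m} -> R) : OmegaM R m :=
  \sum_(i < m) \sum_(S : {set 'I_m} | i \notin S) a i S *: mbas (edge i S).

Lemma mhomog_edge_sum a : mhomog 2 (-1) (edge_sum a).
Proof.
apply: supported_sum => i _; apply: supported_sum => S _.
by apply: supportedZ; exact: mhomog_edge.
Qed.

Lemma mcoeff_edge_sumE a W : (edge_sum a)@_W =
  \sum_(i < m) \sum_(S : {set 'I_m} | i \notin S) a i S * (edge i S == W)%:R.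
Proof.
rewrite mcoeff_sum; apply: eq_bigr => i _; rewrite mcoeff_sum.
by apply: eq_bigr => S _; rewrite mcoeffZ mcoeffU.
Qed.

Lemma mcoeff_edge_sum a i S : i \notin S -> (edge_sum a)@_(edge i S) = a i S.
Proof.
move=> iS; rewrite mcoeff_edge_sumE (bigD1 i) //= (bigD1 S) //= eqxx mulr1.
rewrite big1 ?addr0 => [|T /andP[iT TS]]; last first.
  case: eqP => [/edge_inj[]//|_]; last by rewrite mulr0.
  by move=> _ TE; rewrite TE eqxx in TS.
rewrite big1 ?addr0 // => j ji; rewrite big1 // => T jT.
case: eqP => [/edge_inj[]//|_]; last by rewrite mulr0.
by move=> jE; rewrite jE eqxx in ji.
Qed.

Lemma edge_sum_expand x : mhomog 2 (-1) x ->
  x = edge_sum (fun i S => x@_(edge i S)).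
Proof.
move=> hx; apply/malgP => W; have [[i [S [iS ->]]]|noE] :=
  pselect (exists i S, i \notin S /\ W = edge i S).
  by rewrite mcoeff_edge_sum.
rewrite mcoeff_outdom; last first.
  apply/negP => /hx[sW nW]; apply: noE; apply: word_edge.
    by move=> i; have [] := sW i.
  by have /oppr_inj[] := nW.
rewrite mcoeff_edge_sumE big1 // => i _; rewrite big1 // => S iS.
case: eqP => [E|_]; last by rewrite mulr0.
by case: noE; exists i, S; rewrite E.
Qed.

Lemma mbdry_edge i S : i \notin S ->
  mbdry (mbas (edge i S)) = mbas (vertex (i |: S)) - mbas (vertex S).
Proof.
move=> iS; rewrite mbdry_bas (bigD1 i) //= [X in _ + X]big1 => [|j ji]; last first.
  rewrite bdry_word_nb0 ?nb_edge ?(negPf ji) //.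
  by rewrite [replace_factor _ _ _]linear0 scaler0.
rewrite addr0 big1 => [|j ji]; last first.
  by rewrite nb_edge -(inj_eq val_inj) (ltn_eqF ji).
rewrite expr0 scale1r tnth_edge eqxx bdry_word_cons dia0r scaler0 addr0.
rewrite /bdry_letter eqxx diaBl 2!dia_bas replace_factorB 2!replace_factor_bas.
have -> : set_factor (edge i S) i [:: Lc] = vertex (i |: S).
  apply: eq_from_tnth => j; rewrite tnth_mktuple tnth_vertex tnth_edge.
  by rewrite finset.in_setU1; case: eqP.
suff -> : set_factor (edge i S) i [:: La] = vertex S by [].
apply: eq_from_tnth => j; rewrite tnth_mktuple tnth_vertex tnth_edge.
by case: eqP => [->|//]; rewrite (negPf iS).
Qed.

(** At each vertex, the flow coming in minus the flow going out. *)
Lemma mbdry_edge_sum a : mbdry (edge_sum a) =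
  \sum_(T : {set 'I_m}) (\sum_(i in T) a i (T :\ i) - \sum_(i | i \notin T) a i T)
    *: mbas (vertex T).
Proof.
under [RHS]eq_bigr do rewrite scalerBl 2!scaler_suml.
rewrite [RHS]sumrB [X in X - _](exchange_big_dep xpredT); last by [].
rewrite [X in _ - X](exchange_big_dep xpredT); last by [].
rewrite mbdry_sum -sumrB; apply: eq_bigr => i _.
rewrite mbdry_sum [X in X - _](reindex_onto (fun S : {set 'I_m} => i |: S)
  (fun S => S :\ i)) /= => [|T iT]; last by rewrite finset.setD1K.
rewrite [X in X - _](eq_bigl (fun S : {set 'I_m} => i \notin S)) => [|S]; last first.
  rewrite finset.setU11 /=; apply/eqP/idP => [<-|iS]; first by rewrite finset.setD11.
  by rewrite finset.setU1K.
rewrite -sumrB; apply: eq_bigr => S iS; rewrite mbdryZ (mbdry_edge iS).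
by rewrite scalerBr (finset.setU1K iS).
Qed.

Lemma mcoeff_vertex_sum (b : {set 'I_m} -> R) T :
  (\sum_(S : {set 'I_m}) b S *: mbas (vertex S))@_(vertex T) = b T.
Proof.
rewrite mcoeff_sum (eq_bigr (fun S => b S * (S == T)%:R)) => [|S _]; last first.
  by rewrite mcoeffZ mcoeffU (inj_eq vertex_inj).
rewrite (bigD1 T) //= eqxx mulr1 big1 ?addr0 // => S /negPf ->.
by rewrite mulr0.
Qed.

Lemma permw_edge (s : {perm 'I_m}) i S :
  permw s (edge (s i) (s @: S)) = edge i S.
Proof.
apply: eq_from_tnth => j; rewrite tnth_mktuple !tnth_edge (inj_eq perm_inj).
by rewrite mem_imset //; exact: perm_inj.
Qed.

Lemma mperm_edge (s : {perm 'I_m}) i S :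
  mperm s (mbas (edge (s i) (s @: S))) = mbas (edge i S).
Proof.
rewrite mperm_bas permw_edge /perm_exp big1 => [|j _]; first by rewrite scale1r.
rewrite big1 // => k /andP[jk _]; rewrite !nb_edge !(inj_eq perm_inj).
by case: eqP => // <-; rewrite -[k == _](inj_eq val_inj) gtn_eqF.
Qed.

Lemma mperm_edge_sum (s : {perm 'I_m}) a :
  mperm s (edge_sum a) = edge_sum (fun i S => a (s i) (s @: S)).
Proof.
rewrite mperm_sum (reindex_inj (@perm_inj _ s)); apply: eq_bigr => i _.
rewrite mperm_sum (reindex_inj (imset_inj (@perm_inj _ s))) /=.
apply: eq_big => [S|S _]; first by rewrite (mem_imset _ _ (@perm_inj _ s)).
by rewrite mpermZ mperm_edge.
Qed.

End CubeEdges.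

(** * The symmetric element *)

Section Symmetric.
Variables (R : realType) (m : nat).
Local Notation mbas := (mbas R).
Implicit Types (i j : 'I_m) (S T : {set 'I_m}).

(** Once the weights depend only on the number of c's, the boundary condition is
    a recursion for them; its solution is the probability that a uniformly
    random maximal path in the cube runs through a given edge. *)
Definition path_weight (k : nat) : R := (m * 'C(m.-1, k))%:R^-1.

Definition sym_edges : OmegaM R m := edge_sum (fun _ S => path_weight #|S|).

Hypothesis m_gt0 : (0 < m)%N.

Lemma path_weight_rec k : (k < m)%N ->
  k%:R * path_weight k.-1 - (m - k)%:R * path_weight k = - (k == 0%N)%:R.
Proof.
case: k => [_|k km].
  by rewrite mul0r subn0 /path_weight bin0 muln1 sub0r mulfV // pnatr_eq0 -lt0n.
have m1 : (m - k.+1 = m.-1 - k)%N by case: (m) km.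
have bin_gt (j : nat) : (j <= m.-1)%N -> ('C(m.-1, j)%:R : R) != 0.
  by move=> jm; rewrite pnatr_eq0 -lt0n bin_gt0.
have mn0 : (m%:R : R) != 0 by rewrite pnatr_eq0 -lt0n.
have km1 : (k.+1 <= m.-1)%N by case: (m) km.
have E : (k.+1%:R * 'C(m.-1, k.+1)%:R = (m - k.+1)%:R * 'C(m.-1, k)%:R :> R).
  by rewrite -!natrM mul_bin_left m1.
rewrite oppr0 /path_weight /= !natrM; apply/eqP; rewrite subr_eq0.
rewrite eqr_div ?mulf_neq0 ?bin_gt ?(ltnW km1) //.
by rewrite mulrCA E mulrCA.
Qed.

Lemma path_weight_balance T :
  \sum_(i in T) path_weight #|T :\ i| - \sum_(i | i \notin T) path_weight #|T| =
  (T == [set: 'I_m]%SET)%:R - (T == finset.set0)%:R.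
Proof.
rewrite (eq_bigr (fun=> path_weight #|T|.-1)) => [|i iT]; last first.
  by rewrite [in RHS](cardsD1 i) iT.
rewrite !sumr_const -[X in X - _]mulr_natl -[X in _ - X]mulr_natl.
have -> : #|[pred i | i \notin T]| = (m - #|T|)%N.
  have E : (#|T| + #|[pred i | i \notin T]| = m)%N.
    by have := cardC (mem T); rewrite card_ord.
  by rewrite -[X in (X - _)%N]E addKn.
case: eqVneq => [->|TT]; last first.
  have Tm : (#|T| < m)%N.
    by rewrite -[X in (_ < X)%N]card_ord -cardsT proper_card // properT.
  by rewrite (path_weight_rec Tm) cards_eq0 sub0r.
rewrite cardsT card_ord subnn mul0r subr0 /path_weight binn muln1 mulfV; last first.
  by rewrite pnatr_eq0 -lt0n.
by rewrite -cards_eq0 cardsT card_ord (gtn_eqF m_gt0) subr0.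
Qed.

Lemma sum_vertex_delta T0 :
  \sum_(T : {set 'I_m}) (T == T0)%:R *: mbas (vertex T) = mbas (vertex T0).
Proof.
rewrite (bigD1 T0) //= eqxx scale1r big1 => [|T /negPf ->].
  exact: addr0.
exact: scale0r.
Qed.

Lemma Rset_sym_edges : Rset sym_edges.
Proof.
split; first exact: mhomog_edge_sum.
rewrite mbdry_edge_sum.
under eq_bigr do rewrite path_weight_balance scalerBl.
rewrite [LHS]sumrB 2!sum_vertex_delta.
have -> : vertex [set: 'I_m]%SET = [tuple [:: Lc] | _ < m].
  by apply: eq_from_tnth => i; rewrite !tnth_mktuple finset.in_setT.
suff -> : vertex (@finset.set0 'I_m) = [tuple [:: La] | _ < m] by [].
by apply: eq_from_tnth => i; rewrite !tnth_mktuple finset.in_set0.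
Qed.

Lemma mperm_sym_edges (s : {perm 'I_m}) : mperm s sym_edges = sym_edges.
Proof.
rewrite mperm_edge_sum; apply: eq_bigr => i _; apply: eq_bigr => S _.
by rewrite card_imset //; exact: perm_inj.
Qed.

(** By symmetry under the transposition of [i] and [j], all edges out of [T] have
    the same coefficient; vanishing of the boundary at [T] then expresses it by
    the coefficients of the edges into [T]. *)
Lemma sym_cycle_eq0 (z : OmegaM R m) : mhomog 2 (-1) z -> mbdry z = 0 ->
  (forall s : {perm 'I_m}, mperm s z = z) -> z = 0.
Proof.
move=> hz; set a := fun i S => z@_(edge i S).
have zE : z = edge_sum a := edge_sum_expand hz.
move=> dz sz.
have a_sym i j T : i \notin T -> j \notin T -> a i T = a j T.
  move=> iT jT; rewrite /a -{1}(sz (tperm i j)) {1}zE mperm_edge_sum.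
  rewrite mcoeff_edge_sum // tpermL; congr (a j _).
  apply/setP => k; rewrite -{1}(tpermK i j k) mem_imset; last exact: perm_inj.
  by case: tpermP => [->|->|//]; rewrite (negPf iT) (negPf jT).
have a0 n T : #|T| = n -> forall i, i \notin T -> a i T = 0.
  elim/ltn_ind: n T => n IHn T Tn i iT.
  have := congr1 (mcoeff (vertex T)) dz.
  rewrite {1}zE mbdry_edge_sum mcoeff_vertex_sum mcoeff0 big1 => [|j jT]; last first.
    apply: (IHn #|T :\ j|) => //; last by rewrite finset.setD11.
    by rewrite -Tn [X in (_ < X)%N](cardsD1 j) jT.
  rewrite sub0r (eq_bigr (fun=> a i T)) => [|j jT]; last exact: a_sym.
  rewrite sumr_const => /eqP; rewrite oppr_eq0 mulrn_eq0 => /orP[|/eqP //].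
  move=> /eqP/card0_eq noT; have : i \in [pred j | j \notin T] by [].
  by rewrite noT.
rewrite zE /edge_sum big1 // => i _; rewrite big1 // => S iS.
by rewrite (a0 _ _ erefl) ?scale0r.
Qed.

Lemma symmetric_geom_series (x : OmegaM R m) :
  (forall s : {perm 'I_m}, mperm s x = x) -> symmetric_bar (geom_series x).
Proof.
move=> sx s [|n]; first exact: linear0.
rewrite geom_seriesS; elim: n => [|n IHn]; first exact: mperm_nil.
by rewrite mdia_expS mperm_mdia sx IHn.
Qed.

Theorem unique_symmetric_rigid_MC :
  exists! om : bar R m, [/\ MC om, rigid om & symmetric_bar om].
Proof.
exists (geom_series sym_edges); split.
  split; first exact: MC_geom_series Rset_sym_edges.
    exact: rigid_geom_series Rset_sym_edges.
  exact/symmetric_geom_series/mperm_sym_edges.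
move=> om [MCom rig sym]; have [[hx dx] ->] := rigid_geom m_gt0 MCom rig.
have [hs ds] := Rset_sym_edges; congr geom_series; apply/eqP; rewrite -subr_eq0.
apply/eqP; apply: sym_cycle_eq0.
- by rewrite -scaleN1r; apply: mhomogD => //; exact: mhomogZ.
- by rewrite [mbdry _]linearB /= ds dx subrr.
- by move=> s; rewrite [mperm _ _]linearB /= mperm_sym_edges sym.
Qed.

End Symmetric.

(** * Characteristic maps at strings containing a unit *)

Lemma cat_eq_cat_cons (T : Type) (s1 s2 u v : seq T) a : s1 ++ s2 = u ++ a :: v ->
  (exists s, u = s1 ++ s /\ s2 = s ++ a :: v) \/
  (exists s, s1 = u ++ a :: s /\ v = s ++ s2).
Proof.
elim: s1 u => [|b s1 IH] [|c u] /=.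
- by move=> ->; left; exists [::].
- by move=> ->; left; exists (c :: u).
- by case=> -> <-; right; exists s1.
- case=> -> /IH[[s [-> ->]]|[s [-> ->]]]; first by left; exists s.
  by right; exists s.
Qed.

Section CharacteristicMap.
Variables (R : realType) (G : lieGroupoid R) (E : ruth G).
Variable kE : Omega R -> bcochain E.
Hypotheses (E_unital : unital E) (kE_char : is_char_map kE).
Local Notation bas := (bas R).
Implicit Types (x y : obj G) (g : seq (arr G)) (w : word).

Let kE_circ : forall k l k' l' u v, homog k l u -> homog k' l' v ->
    kE (circ u v) = cocirc k (kE u) (kE v) :=
  let: And5 _ _ kc _ _ := kE_char in kc.
Let kE_face : forall k l i u, homog k l u -> (1 <= i <= k)%N ->
    kE (face i u) = coface i (kE u) :=
  let: And5 _ _ _ _ (conj kf _) := kE_char in kf.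
Let kE_L : forall n, (1 <= n)%N -> kE (Lgen R n) = ruth_op E n :=
  let: And5 _ _ _ _ (conj _ kL) := kE_char in kL.

Lemma char_La u v x y g : kE (bas (u ++ La :: v)) x y g =
  if is_string x y g then
    if drop (size u) g is h1 :: h2 :: r
    then kE (bas (u ++ v)) x y (take (size u) g ++ gmul h1 h2 :: r) else 0
  else 0.
Proof.
rewrite -face_bas (kE_face (@homog_bas R (u ++ v))) //.
by rewrite /= ltnS size_cat leq_addr.
Qed.

Lemma char_Lc u v x y g : kE (bas (u ++ Lc :: v)) x y g =
  cocirc (size u).+1 (kE (bas u)) (kE (bas v)) x y g.
Proof. by rewrite -circ_bas (kE_circ (@homog_bas R u) (@homog_bas R v)). Qed.

Lemma char_nseq n : kE (bas (nseq n Lb)) = ruth_op E n.+1.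
Proof. by rewrite -(kE_L (n := n.+1)). Qed.

(** The letter between two arrows tells how they are combined: [La] multiplies
    them, [Lc] composes the operators before and after, and along [Lb] both are
    arguments of the same operation. A unit next to some [Lb] and to no [La] is
    thus an argument of some R_k with k >= 2. The ends of the string behave as
    [Lc], whence the default letter. *)
Lemma char_unit_vanish w1 w2 x y g1 g2 z :
  size w1 = size g1 -> size w2 = size g2 ->
  last Lc w1 != La -> head Lc w2 != La ->
  (last Lc w1 == Lb) || (head Lc w2 == Lb) ->
  kE (bas (w1 ++ w2)) x y (g1 ++ gunit z :: g2) = 0.
Proof.
move: {2}(w1 ++ w2) (erefl (w1 ++ w2)) => w.
elim/word_gen_ind: w w1 w2 x y g1 g2 => [n|u v IH|u v IHu IHv] w1 w2 x y g1 g2 wE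
  s1 s2 l1 l2 lb; rewrite wE.
- rewrite char_nseq.
  have sg : size (g1 ++ gunit z :: g2) = n.+1.
    by rewrite size_cat /= addnS -s1 -s2 -size_cat wE size_nseq.
  have n0 : (2 <= n.+1)%N.
    move: lb; rewrite ltnS lt0n; apply: contraL => /eqP n0.
    by move: wE; rewrite n0; case: (w1) => //; case: (w2).
  have [gs|gns] := boolP (is_string x y (g1 ++ gunit z :: g2)).
    apply: (proj2 E_unital) => //; exists z.
    by rewrite mem_cat inE eqxx orbT.
  by have [-> //] := ruth_in_A E n.+1; rewrite (negPf gns).
- rewrite char_La; case: ifP => // _.
  have [[v1 [uE w2E]]|[v1 [w1E vE]]] := cat_eq_cat_cons wE.
    subst u w2; case: v1 IH s2 l2 lb {wE} => // l v1 IH s2 l2 lb.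
    have -> : size (w1 ++ l :: v1) = (size g1 + (size v1).+1)%N.
      by rewrite size_cat s1.
    rewrite drop_cat take_cat ltnNge leq_addr addKn /=.
    case g2E: (drop (size v1) g2) => [|h1 [|h2 r]] //.
    have -> : (g1 ++ gunit z :: take (size v1) g2) ++ gmul h1 h2 :: r =
              g1 ++ gunit z :: (take (size v1) g2 ++ gmul h1 h2 :: r).
      by rewrite -catA.
    rewrite -[(w1 ++ _) ++ v]catA.
    apply: (IH w1 (l :: v1 ++ v)) => //; first by rewrite -catA.
    have := congr1 size (cat_take_drop (size v1) g2); move: s2.
    by rewrite g2E !size_cat /= size_cat /=; lia.
  subst w1 v; case: v1 IH s1 l1 lb {wE} => [|l v1] IH s1; rewrite last_cat //= => l1 lb.
  have ug1 : (size u < size g1)%N by rewrite -s1 size_cat /=; lia.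
  rewrite drop_cat take_cat ug1.
  case g1E: (drop (size u) g1) => [|h1 [|h2 r]] /=.
  + by have := size_drop (size u) g1; rewrite g1E /=; lia.
  + by have := size_drop (size u) g1; rewrite g1E /= -s1 size_cat /=; lia.
  have -> : take (size u) g1 ++ gmul h1 h2 :: r ++ gunit z :: g2 =
            (take (size u) g1 ++ gmul h1 h2 :: r) ++ gunit z :: g2.
    by rewrite -catA.
  have -> : u ++ l :: v1 ++ w2 = (u ++ l :: v1) ++ w2 by rewrite -catA.
  apply: (IH (u ++ l :: v1) w2) => //; rewrite ?last_cat //.
  + by rewrite -catA.
  + rewrite !size_cat size_takel ?(ltnW ug1) //=.
    by have := size_drop (size u) g1; move: s1; rewrite g1E size_cat /=; lia.
- rewrite char_Lc /cocirc.
  have [[v1 [uE w2E]]|[v1 [w1E vE]]] := cat_eq_cat_cons wE.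
    subst u w2.
    have -> : (size (w1 ++ v1)).+1 = (size g1 + (size v1).+1)%N.
      by rewrite size_cat s1 addnS.
    set c := kE (bas (w1 ++ v1)) _ _ _; suff -> : c = 0 by rewrite comp_lfun0l.
    rewrite /c take_cat ltnNge leq_addr addKn /=; apply: (IHu w1 v1) => //.
    + by rewrite size_takel // -s2 size_cat leq_addr.
    + by move: l2; case: (v1).
    + by move: lb; case: (v1).
  subst w1 v; move: s1 l1 lb; rewrite last_cat /= => s1 l1 lb.
  set c := kE (bas (v1 ++ w2)) _ _ _; suff -> : c = 0 by rewrite comp_lfun0r.
  have ug1 : ((size u).+1 <= size g1)%N by rewrite -s1 size_cat /=; lia.
  rewrite /c drop_cat; move: ug1; rewrite leq_eqVlt => /orP[/eqP ug1|ug1].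
    rewrite ug1 ltnn subnn drop0; apply: (IHv v1 w2 _ _ [::]) => //.
    by move: s1; rewrite size_cat -ug1 /=; lia.
  rewrite ug1; apply: (IHv v1 w2) => //.
  by rewrite size_drop -s1 size_cat /=; lia.
Qed.

Lemma is_string_cat x y g1 h g2 : is_string x y (g1 ++ h :: g2) ->
  (if g1 is k :: g1' then gsrc (last k g1') = gtgt h else true) /\
  (if g2 is k :: _ then gtgt k = gsrc h else true).
Proof.
elim: g1 y => [|k g1 IH] y /=.
  by case: g2 => // k g2 /= /andP[_ /andP[/eqP]].
case/andP=> _ /[dup] /IH[i1 i2] gs; split=> //.
by case: g1 {IH} i1 gs => //= _ /andP[/eqP].
Qed.

(** A unit may be multiplied into either of its neighbours. *)
Lemma char_unit_swapa w1 w2 l x y g1 g2 z :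
  (size w1).+1 = size g1 -> (size w2).+1 = size g2 ->
  kE (bas (w1 ++ La :: l :: w2)) x y (g1 ++ gunit z :: g2) =
  kE (bas (w1 ++ l :: La :: w2)) x y (g1 ++ gunit z :: g2).
Proof.
case/lastP: g1 => // g1 h1; rewrite size_rcons => -[s1].
case: g2 => // h2 g2 [s2].
have -> : w1 ++ [:: l, La & w2] = (w1 ++ [:: l]) ++ La :: w2 by rewrite -catA.
rewrite 2!char_La; case: ifP => // gs.
have [] := is_string_cat gs; rewrite gtgt_unit gsrc_unit => h1z h2z.
have {}h1z : gsrc h1 = z.
  by case: (g1) h1z => [|k g] //=; rewrite last_rcons.
rewrite cat_rcons s1 size_cat s1 addn1 drop_size_cat // take_size_cat //.
rewrite -(cat_rcons h1 g1) drop_size_cat ?size_rcons // take_size_cat ?size_rcons //.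
by rewrite -h1z gmul1 h1z -h2z g1mul cat_rcons -catA.
Qed.

Lemma char_unit_swap w1 w2 l l' x y g1 g2 z :
  (size w1).+1 = size g1 -> (size w2).+1 = size g2 ->
  kE (bas (w1 ++ l :: l' :: w2)) x y (g1 ++ gunit z :: g2) =
  kE (bas (w1 ++ l' :: l :: w2)) x y (g1 ++ gunit z :: g2).
Proof.
move=> s1 s2.
have bc0 k k' : k != La -> k' != La -> (k == Lb) || (k' == Lb) ->
    kE (bas (w1 ++ k :: k' :: w2)) x y (g1 ++ gunit z :: g2) = 0.
  move=> ka k'a kb; rewrite -(cat_rcons k w1); apply: char_unit_vanish => //.
  - by rewrite size_rcons.
  - by rewrite last_rcons.
  - by rewrite last_rcons.
have [->|la] := eqVneq l La; first exact: char_unit_swapa.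
have [->|l'a] := eqVneq l' La; first by apply: esym; exact: char_unit_swapa.
have [->|ll'] := eqVneq l l'; first by [].
have lb : (l == Lb) || (l' == Lb).
  by case: l la ll' => //; case: l' l'a.
by rewrite bc0 // bc0 // orbC.
Qed.

End CharacteristicMap.

(** * Tensor products of graded linear maps *)

Section GradedTensor.
Variables (R : realType) (m : nat).

Lemma tpure_eq0 (V : 'I_m -> vectType R) (v : forall i, V i) i :
  v i = 0 -> tpure v = 0.
Proof.
move=> vi0; apply/ffunP => I; rewrite !ffunE (bigD1 i) //= vi0 linear0.
by rewrite mul0r.
Qed.

Lemma tpure_basis (V : 'I_m -> vectType R)
    (I J : {dffun forall i : 'I_m, 'I_(\dim {: V i})}) :
  tpure (fun i => tnth (vbasis {: V i}) (I i)) J = (J == I)%:R.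
Proof.
rewrite ffunE; case: eqP => [->|/eqP JI].
  rewrite big1 // => i _.
  by rewrite (tnth_nth 0) coord_free ?eqxx // (basis_free (vbasisP _)).
have [i iJI] : exists i, J i != I i.
  apply/existsP; apply: contraNT JI; rewrite negb_exists => /forallP JI.
  by apply/eqP/ffunP => i; apply/eqP; have := JI i; rewrite negbK.
rewrite (bigD1 i) //= (tnth_nth 0) coord_free ?(basis_free (vbasisP _)) //.
by rewrite eq_sym (negPf iJI) mul0r.
Qed.

Lemma tensor_basis_sum (V : 'I_m -> vectType R) (t : tensor V) :
  \sum_(I : {dffun forall i : 'I_m, 'I_(\dim {: V i})})
    (t I : R) *: tpure (fun i => tnth (vbasis {: V i}) (I i)) = t.
Proof.
apply/ffunP => J; rewrite sum_ffunE (bigD1 J) //= [X in X + _]ffunE.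
rewrite tpure_basis eqxx [_ *: _]mulr1 big1 => [|I IJ]; first exact: addr0.
by rewrite ffunE tpure_basis eq_sym (negPf IJ) [LHS]mulr0.
Qed.

Lemma tmap_eq0 (V W : 'I_m -> vectType R) (f : forall i, 'Hom(V i, W i)) i :
  f i = 0 -> tmap f = 0.
Proof.
move=> fi0; rewrite /tmap.
have -> : (fun t : tensor V =>
    \sum_(I : {dffun forall i : 'I_m, 'I_(\dim {: V i})})
      (t I : R) *: tpure (fun i => f i (tnth (vbasis {: V i}) (I i)))) =
    (\0 : {linear tensor V -> tensor W}).
  apply: funext => t; rewrite big1 // => I _.
  by rewrite (@tpure_eq0 _ _ i) ?scaler0 // fi0 zero_lfunE.
by [].
Qed.

Lemma tmap_id (V : 'I_m -> vectType R) (f : forall i, 'Hom(V i, V i)) :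
  (forall i, f i = \1%VF) -> tmap f = \1%VF.
Proof.
move=> f1; rewrite /tmap.
have -> : (fun t : tensor V =>
    \sum_(I : {dffun forall i : 'I_m, 'I_(\dim {: V i})})
      (t I : R) *: tpure (fun i => f i (tnth (vbasis {: V i}) (I i)))) = idfun.
  apply: funext => t; rewrite -[RHS]tensor_basis_sum; apply: eq_bigr => I _.
  congr (_ *: _); apply/ffunP => J; rewrite !ffunE; apply: eq_bigr => i _.
  by rewrite f1 id_lfunE.
by [].
Qed.

Lemma ktmap_eq0 (V W : 'I_m -> gradedVect R) l (f : forall i, 'Hom(V i, W i)) i :
  f i = 0 -> ktmap l f = 0.
Proof. by move=> fi0; apply: (@tmap_eq0 _ _ _ i); rewrite fi0 comp_lfun0l. Qed.

Lemma sign_op0 (V : gradedVect R) : sign_op V 0 = \1%VF.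
Proof.
rewrite -gv_sum; apply: eq_bigr => p _.
by rewrite mul0r expr0z scale1r.
Qed.

Lemma ktmap_id (V : 'I_m -> gradedVect R) l (f : forall i, 'Hom(V i, V i)) :
  (forall i, l i = 0) -> (forall i, f i = \1%VF) -> ktmap l f = \1%VF.
Proof.
move=> l0 f1; apply: tmap_id => i.
by rewrite f1 big1 // sign_op0 comp_lfun1l.
Qed.

Lemma eq_ktmap (V W : 'I_m -> gradedVect R) l l' (f f' : forall i, 'Hom(V i, W i)) :
  (forall i, l i = l' i) -> (forall i, f i = f' i) -> ktmap l f = ktmap l' f'.
Proof.
move=> /funext lE fE; have {}fE : f = f' by apply: functional_extensionality_dep.
by rewrite lE fE.
Qed.

End GradedTensor.

(** * Rigid tensor products of unital representations *)

Section Squares.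
Variables (R : realType) (m : nat).
Local Notation mbas := (mbas R).

Lemma mdia_expD (x : OmegaM R m) p q :
  mdia_exp x (p + q) = mdia (mdia_exp x p) (mdia_exp x q).
Proof.
elim: p => [|p IHp]; first by rewrite mdia1l.
by rewrite addSn 2!mdia_expS {}IHp mdiaA.
Qed.

Lemma mdia_exp1 (x : OmegaM R m) : mdia_exp x 1 = x.
Proof. exact: mdia1r. Qed.

Lemma supported_mdia_exp (x : OmegaM R m) n : mhomog 2 (-1) x ->
  supported (fun W => forall i, size (tnth W i) = n) (mdia_exp x n).
Proof.
move=> hx; rewrite -word_image_nseq.
apply: supported_weaken (@mhomog_word_image _ _ _ hx (nseq n Lb)) => W [sW _] i.
by have [] := sW i; rewrite size_nseq.
Qed.

Lemma supported_edges (x : OmegaM R m) : mhomog 2 (-1) x ->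
  supported (fun W => exists i S, W = edge i S) x.
Proof.
move=> hx W /hx[sW nW]; have [||i [S [_ ->]]] := @word_edge m W; last by exists i, S.
- by move=> i; have [] := sW i.
- by have /oppr_inj[] := nW.
Qed.

Lemma shuffle_sign_edge (i j : 'I_m) (S T : {set 'I_m}) :
  shuffle_sign R (edge i S) (edge j T) = (-1) ^+ (j < i)%N.
Proof.
rewrite shuffle_signE (eq_shuffle_exp (nb_edge i S) (nb_edge j T)).
rewrite shuffle_exp_deltal; congr (_ ^+ _).
rewrite big_mkcond (bigD1 j) //= eqxx big1 ?addn0 => [|k /negPf ->].
  by case: (j < i)%N.
by case: ifP.
Qed.

Variables (V : lmodType R) (K : mword m -> V).

Lemma lsumP (c : R) (x y : OmegaM R m) :
  lsum K (c *: x + y) = c *: lsum K x + lsum K y.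
Proof. exact: linearP. Qed.

Lemma lsumZ (c : R) (x : OmegaM R m) : lsum K (c *: x) = c *: lsum K x.
Proof. exact: linearZ. Qed.

Lemma lsum_eq0 (P : mword m -> Prop) (x : OmegaM R m) :
  supported P x -> (forall W, P W -> K W = 0) -> lsum K x = 0.
Proof.
by move=> Px K0; rewrite /lsum big_seq big1 // => W /Px /K0 ->; exact: scaler0.
Qed.

(** An element of odd degree squares to zero under any operation that is
    symmetric in two adjacent columns, because exchanging two columns with one b
    each costs a sign. There is no sign when both b's are in the same factor, so
    the operation has to vanish there. *)
Lemma lsum_square_eq0 (u v x : OmegaM R m) : mhomog 2 (-1) x ->
  (forall A B i S j T, A \in msupp u -> B \in msupp v ->
    K (mcat A (mcat (mcat (edge i S) (edge j T)) B)) =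
    K (mcat A (mcat (mcat (edge j T) (edge i S)) B))) ->
  (forall A B i S T, A \in msupp u -> B \in msupp v ->
    K (mcat A (mcat (mcat (edge i S) (edge i T)) B)) = 0) ->
  lsum K (mdia u (mdia (mdia x x) v)) = 0.
Proof.
move=> hx Ksym Kdiag.
pose F y z := lsum K (mdia u (mdia (mdia y z) v)).
have Fl z : linear (F^~ z).
  by move=> c a b; rewrite /F 2!mdiaPl mdiaPr lsumP.
have Fr y : linear (F y).
  by move=> c a b; rewrite /F mdiaPr mdiaPl mdiaPr lsumP.
have Fbas A B C D : lsum K (mdia (mbas A) (mdia (mdia (mbas C) (mbas D)) (mbas B))) =
    (shuffle_sign R C D * (shuffle_sign R (mcat C D) B *
       shuffle_sign R A (mcat (mcat C D) B))) *:
    K (mcat A (mcat (mcat C D) B)).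
  by rewrite mdia_bas mdiaZl mdia_bas 2!mdiaZr mdia_bas 3!lsumZ lsumU 2!scalerA mulrA.
have Fanti : F x x = - F x x.
  apply: (bilinear_ext (F := F) (G := fun y z => - F z y)) 
    => [| |z|y|C D xC xD].
  - exact: Fl.
  - exact: Fr.
  - by move=> c a b; rewrite Fr opprD scalerN.
  - by move=> c a b; rewrite Fl opprD scalerN.
  have [i [S CE]] := supported_edges hx xC; have [j [T DE]] := supported_edges hx xD.
  apply: (bilinear_ext (F := fun u v => lsum K (mdia u (mdia (mdia << C >> << D >>) v)))
    (G := fun u v => - lsum K (mdia u (mdia (mdia << D >> << C >>) v))))
    => [b|a|b|a|A B uA vB].
  - by move=> c y z; rewrite mdiaPl lsumP.
  - by move=> c y z; rewrite 2!mdiaPr lsumP.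
  - by move=> c y z; rewrite mdiaPl lsumP opprD scalerN.
  - by move=> c y z; rewrite 2!mdiaPr lsumP opprD scalerN.
  rewrite [LHS]Fbas [X in _ = - X]Fbas CE DE.
  have [ij|ij] := eqVneq i j.
    by subst j; rewrite Kdiag // Kdiag // 2!scaler0 oppr0.
  rewrite (Ksym A B j T i S uA vB) -scaleNr; congr (_ *: _).
  rewrite 2!shuffle_sign_edge !(shuffle_sign_catl, shuffle_sign_catr).
  move: (shuffle_sign R (edge i S) B) (shuffle_sign R (edge j T) B) => c1 c2.
  move: (shuffle_sign R A (edge i S)) (shuffle_sign R A (edge j T)) => c3 c4.
  move: (shuffle_sign R A B) => c5.
  case: (ltngtP i j) => [_|_|/ord_inj ijE]; last by rewrite ijE eqxx in ij.
    by rewrite expr0 expr1; ring.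
  by rewrite expr0 expr1; ring.
have : 2%:R *: F x x = 0 by rewrite scaler_nat mulr2n {1}Fanti addNr.
by move/eqP; rewrite scaler_eq0 pnatr_eq0 => /eqP.
Qed.

End Squares.

Section UnitalTensor.
Variables (R : realType) (m : nat) (G : lieGroupoid R) (E : 'I_m -> ruth G).
Variable kE : forall i, Omega R -> bcochain (E i).
Hypotheses (E_unital : forall i, unital (E i)).
Hypothesis (kE_char : forall i, is_char_map (kE i)).
Variable x : OmegaM R m.
Hypothesis x_homog : mhomog 2 (-1) x.

Lemma tensor_op_unit z :
  tensor_op (geom_series x) kE 1 z z [:: gunit z] = \1%VF.
Proof.
pose K (W : mword m) := ktmap (fun i => - (nb (tnth W i))%:Z)
  (fun i => kE i (bas R (tnth W i)) z z [:: gunit z]).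
rewrite -[LHS]/(lsum K (mdiag R m [::])) lsumU; apply: ktmap_id => i.
  by rewrite tnth_mktuple oppr0.
rewrite tnth_mktuple (char_nseq (kE_char i) 0).
by have [-> _] := E_unital i.
Qed.

Lemma tensor_op_vanish n y y' g1 g2 z :
  (1 <= n)%N -> size (g1 ++ gunit z :: g2) = n.+1 ->
  tensor_op (geom_series x) kE n.+1 y y' (g1 ++ gunit z :: g2) = 0.
Proof.
move=> n0 sg.
pose K (W : mword m) := ktmap (fun i => - (nb (tnth W i))%:Z)
  (fun i => kE i (bas R (tnth W i)) y y' (g1 ++ gunit z :: g2)).
rewrite -[LHS]/(lsum K (mdia_exp x n)).
have {}sg : (size g1 + size g2)%N = n by move: sg; rewrite size_cat /= addnS => -[].
have Kb u v (W : mword m) i : tnth W i = u ++ v ->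
    size u = size g1 -> size v = size g2 ->
    last Lc u != La -> head Lc v != La -> (last Lc u == Lb) || (head Lc v == Lb) ->
    K W = 0.
  move=> Wi su sv lu hv ub; apply: (@ktmap_eq0 _ _ _ _ _ _ i).
  by rewrite Wi; apply: char_unit_vanish.
have Kswap A B i S j T : (forall k, (size (tnth A k)).+1 = size g1) ->
    (forall k, (size (tnth B k)).+1 = size g2) ->
    K (mcat A (mcat (mcat (edge i S) (edge j T)) B)) =
    K (mcat A (mcat (mcat (edge j T) (edge i S)) B)).
  move=> sA sB; apply: eq_ktmap => k.
    by rewrite !tnth_mcat !nb_cat (addnC (nb (tnth (edge i S) k))).
  have letter_edge i' S' : exists l, tnth (edge i' S') k = [:: l].
    by rewrite tnth_edge; case: eqP => _; eexists.
  have [l lE] := letter_edge i S; have [l' l'E] := letter_edge j T.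
  by rewrite !tnth_mcat lE l'E; apply: char_unit_swap.
move: K Kb Kswap => K Kb Kswap; rewrite -sg.
(* First arrow a unit: the leftmost factor x has a b in some component. *)
have [g1_0|g1_0] := posnP (size g1).
  have g2_0 : (0 < size g2)%N by lia.
  rewrite g1_0 -(prednK g2_0) add0n mdia_expS.
  apply: (lsum_eq0 (P := fun W => exists i S B, W = mcat (edge i S) B /\
     forall i, size (tnth B i) = (size g2).-1)).
    apply: supported_mdia (supported_edges x_homog) (supported_mdia_exp x_homog) _.
    by move=> _ B [i [S ->]] sB; exists i, S, B.
  move=> _ [i [S [B [-> sB]]]]; apply: (Kb [::] (Lb :: tnth B i) _ i) => //.
    by rewrite tnth_mcat tnth_edge eqxx.
  by rewrite /= sB prednK.
(* Last arrow a unit: the same for the rightmost factor x. *)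
have [g2_0|g2_0] := posnP (size g2).
  rewrite g2_0 addn0 -(prednK g1_0) -addn1 mdia_expD mdia_exp1.
  apply: (lsum_eq0 (P := fun W => exists i S A, W = mcat A (edge i S) /\
     forall i, size (tnth A i) = (size g1).-1)).
    apply: supported_mdia (supported_mdia_exp x_homog) (supported_edges x_homog) _.
    by move=> A _ sA [i [S ->]]; exists i, S, A.
  move=> _ [i [S [A [-> sA]]]].
  apply: (Kb (rcons (tnth A i) Lb) [::] _ i); rewrite ?last_rcons //.
    by rewrite tnth_mcat tnth_edge eqxx cats0 cats1.
  by rewrite size_rcons sA prednK.
(* Otherwise isolate the two factors x on the two sides of the unit. *)
have -> : (size g1 + size g2 = (size g1).-1 + (1 + 1 + (size g2).-1))%N by lia.
rewrite 3!mdia_expD mdia_exp1; apply: lsum_square_eq0 => //.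
- move=> A B i S j T /(supported_mdia_exp x_homog) sA /(supported_mdia_exp x_homog) sB.
  by apply: Kswap => k; rewrite ?sA ?sB prednK.
- move=> A B i S T /(supported_mdia_exp x_homog) sA /(supported_mdia_exp x_homog) sB.
  apply: (Kb (rcons (tnth A i) Lb) (Lb :: tnth B i) _ i); rewrite ?last_rcons //.
  + by rewrite !tnth_mcat !tnth_edge eqxx cat_rcons.
  + by rewrite size_rcons sA prednK.
  + by rewrite /= sB prednK.
Qed.

Lemma unital_tensor_op : unital_ops (tensor_op (geom_series x) kE).
Proof.
split=> [z|[//|[//|n]] y y' g _ _ sg [z gz]]; first exact: tensor_op_unit.
by case/splitPr: gz sg => g1 g2 sg; apply: tensor_op_vanish.
Qed.

End UnitalTensor.

Theorem theorem5p9 (R : realType) (m : nat) (hm : (2 <= m)%N) :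
  [/\ set_bij (@Rset R m) [set om | MC om /\ rigid om] (@geom_series R m),
      exists! om : bar R m, [/\ MC om, rigid om & symmetric_bar om]
    & forall om : bar R m, MC om -> rigid om ->
      forall (G : lieGroupoid R) (E : 'I_m -> ruth G),
        (forall i, unital (E i)) ->
      forall kE : (forall i, Omega R -> bcochain (E i)),
        (forall i, is_char_map (kE i)) ->
      unital_ops (tensor_op om kE)].
Proof.
have m0 : (0 < m)%N := ltnW hm.
split; [exact: rigid_MC_bij|exact: unique_symmetric_rigid_MC|].
move=> om MCom rig G E E_unital kE kE_char.
have [[x_homog _] ->] := rigid_geom m0 MCom rig.
exact: unital_tensor_op.
Qed.
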